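(* Let $T$ be a symmetric subset of $\mathbb Z_+\times\mathbb Z_+$ (i.e. $(n,m)\in T$ for all $(m,n)\in T$) containing the diagonal $\{(n,n)\colon n\in\mathbb Z_+\}$, and let $Z\subset\mathbb C$ be a determining set for $\mathbb C[z,\bar z]$. Then for any system of complex numbers $\{c_{m,n}\}_{(m,n)\in T}$, the following conditions are equivalent: (i) there exists a positive Borel measure $\mu$ on $\mathbb C$ such that $c_{m,n}=\int_{\mathbb C}z^m\bar z^n\,\mu(dz)$ for all $(m,n)\in T$; (ii) there exists a complex moment sequence $\{\tilde c_{m,n}\}_{m,n=0}^\infty$ such that $\tilde c_{m,n}=c_{m,n}$ for all $(m,n)\in T$; (iii) there exists a system $\{\tilde c_{m,n}\}_{m+n\ge0}\subset\mathbb C$ such that $\tilde c_{m,n}=c_{m,n}$ for all $(m,n)\in T$, and $\sum_{m+n\ge0,\ p+q\ge0}\tilde c_{m+q,n+p}\lambda_{m,n}\overline{\lambda_{p,q}}\ge0$ for all finite systems $\{\lambda_{m,n}\}_{m+n\ge0}\subset\mathbb C$; (iv) $\sum_{(m,n)\in T}p_{m,n}c_{m,n}\ge0$ for every finite system $\{p_{m,n}\}_{(m,n)\in T}\subset\mathbb C$ such that $\sum_{(m,n)\in T}p_{m,n}z^m\bar z^n\ge0$ for all $z\in\mathbb C$; (v) $\sum_{(m,n)\in T}p_{m,n}c_{m,n}\ge0$ for every finite system $\{p_{m,n}\}_{(m,n)\in T}\subset\mathbb C$ for which there exist finitely many rational functions $q_1,\dots,q_k\in\mathbb C_{\mathfrak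 N_+}(z,\bar z)$ such that $\sum_{(m,n)\in T}p_{m,n}z^m\bar z^n=\sum_{j=1}^k|q_j(z,\bar z)|^2$ for all $z\in\mathbb C$, $z\ne0$; (vi) $\sum_{(m,n)\in T}p_{m,n}c_{m,n}\ge0$ for every finite system $\{p_{m,n}\}_{(m,n)\in T}\subset\mathbb C$ for which there exist finitely many rational functions $q_1,\dots,q_k\in\mathbb C_{\mathfrak N_+}(z,\bar z)$ such that $\sum_{(m,n)\in T}p_{m,n}z^m\bar z^n=\sum_{j=1}^k|q_j(z,\bar z)|^2$ for all $z\in Z$, $z\ne0$.
   Context: $\mathbb Z_+=\{0,1,2,\dots\}$. A system of complex numbers is finite if only finitely many of its members are nonzero. The index notation $m+n\ge0$ means $(m,n)\in\mathbb Z\times\mathbb Z$ with $m+n\ge0$. $\mathbb C[z,\bar z]$ is the ring of all complex polynomials in $z$ and $\bar z$; a set $Z\subset\mathbb C$ is determining for $\mathbb C[z,\bar z]$ if every $p\in\mathbb C[z,\bar z]$ with $p(z,\bar z)=0$ for all $z\in Z$ vanishes identically. $\mathbb C_{\mathfrak N_+}(z,\bar z)$ is the set of all functions on $\mathbb C\setminus\{0\}$ of the form $z\mapsto\sum_{m,n\in\mathbb Z,\ m+n\ge0}a_{m,n}z^m\bar z^n$ with $\{a_{m,n}\}$ a finite system of complex numbers. A sequence $\{c_{m,n}\}_{m,n=0}^\infty\subset\mathbb C$ is a complex moment sequence if there is a positive Borel measure $\mu$ on $\mathbb C$ with $c_{m,n}=\int_{\mathbb C}z^m\bar z^n\,\mu(dz)$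 for all $m,n\ge0$. All integrands are tacitly assumed to be summable. *)

(* Defs.v *)
From HB Require Import structures.
From mathcomp Require Import all_boot all_order all_algebra.
From mathcomp Require Import all_classical all_reals all_analysis.
From mathcomp Require Import complex.

Set Implicit Arguments.
Unset Strict Implicit.
Unset Printing Implicit Defensive.

Import Order.TTheory GRing.Theory Num.Theory.
Import numFieldNormedType.Exports.

Local Open Scope classical_set_scope.
Local Open Scope ring_scope.
Local Open Scope complex_scope.

(* A system indexed by a set [A] is a total function on the ambient index type
   whose values outside [A] are never used. *)
Definition finite_system (I : choiceType) (V : nmodType) (A : set I)
    (a : I -> V) : Prop :=
  finite_set [set i | A i /\ a i != 0].

Definition symmetric_set (T : set (nat * nat)) : Prop :=
  forall m n : nat, T (m, n) -> T (n, m).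

Definition Nplus : set (int * int) := [set k | 0 <= k.1 + k.2].

(* [(m, n)] stands for z ^ m * zbar ^ n; [Num.conj] is conjugation on [R[i]]. *)
Definition monom (R : realType) (k : nat * nat) (z : R[i]) : R[i] :=
  z ^+ k.1 * Num.conj z ^+ k.2.

(* Integer exponents; only meaningful for z != 0. *)
Definition laurent_monom (R : realType) (k : int * int) (z : R[i]) : R[i] :=
  z ^ k.1 * Num.conj z ^ k.2.

(* An element of C[z, zbar] is a bivariate polynomial whose outer variable is
   evaluated at z and whose inner variable is evaluated at zbar. *)
Definition eval_zzbar (R : realType) (p : {poly {poly R[i]}}) (z : R[i]) :
    R[i] :=
  p.[z%:P].[Num.conj z].

Definition determining (R : realType) (Z : set R[i]) : Prop :=
  forall p : {poly {poly R[i]}},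
    (forall z, Z z -> eval_zzbar p z = 0) -> forall z, eval_zzbar p z = 0.

(* Only the values of [q] on C \ {0} are constrained. *)
Definition in_CNplus (R : realType) (q : R[i] -> R[i]) : Prop :=
  exists a : int * int -> R[i], finite_system Nplus a /\
    forall z, z != 0 -> q z = \sum_(k \in Nplus) a k * laurent_monom k z.

(* The complex plane with the Borel sigma-algebra of its norm topology; [^o] is
   what gives [R[i]] its topology. *)
Definition complexBorel (R : realType) : measurableType _ :=
  g_sigma_algebraType (@open (R[i])^o).

Definition cintegrable (R : realType) (mu : {measure set (complexBorel R) -> \bar R})
    (f : R[i] -> R[i]) : Prop :=
  mu.-integrable [set: complexBorel R] (fun z => (complex.Re (f z))%:E) /\
  mu.-integrable [set: complexBorel R] (fun z => (complex.Im (f z))%:E).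

Definition cintegral (R : realType) (mu : {measure set (complexBorel R) -> \bar R})
    (f : R[i] -> R[i]) : R[i] :=
  (\int[mu]_(z in [set: complexBorel R]) complex.Re (f z))%R +i*
  (\int[mu]_(z in [set: complexBorel R]) complex.Im (f z))%R.

Definition represents_on (R : realType) (T : set (nat * nat))
    (c : nat * nat -> R[i]) (mu : {measure set (complexBorel R) -> \bar R}) :
    Prop :=
  forall k, T k -> cintegrable mu (monom k) /\ c k = cintegral mu (monom k).

Definition complex_moment_sequence (R : realType) (c : nat * nat -> R[i]) :
    Prop :=
  exists mu : {measure set (complexBorel R) -> \bar R},
    represents_on [set: nat * nat] c mu.

(* Main.v *)
Require Import Defs.
From HB Require Import structures.
From mathcomp Require Import all_boot all_order all_algebra.
From mathcomp Require Import all_classical all_reals all_analysis.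
From mathcomp Require Import measurable_realfun cyclic separable cyclotomic.
From mathcomp Require Import complex.
From mathcomp Require Import zify ring lra.

(* Once a measure exists, (ii) and (iii) follow by integration, the extended
   moments being those of the functions z^m zbar^n with z/zbar := 1 at z = 0.

   Passing from sums of squares to nonnegative polynomials.  On a line through 0
   at angle w, a polynomial p >= 0 becomes a nonnegative polynomial in the radius
   r, and adding eps makes it |P_w(r)|^2.  Multiplying by the Fejer kernel
   |sum_(s < h) (e^(i theta) / w)^s|^2 and averaging over roots of unity w
   gives, after separating even and odd exponents, a sum of squares from
   C_(N_+)(z, zbar); it differs from p + eps by
   1/h sum |m - n| p_(m,n) z^m zbar^n.  The squares
   |1 + |m - n| p_(m,n) z^m zbar^n|^2 turn this error into 1/h times a fixed
   combination of the diagonal monomials |z|^(2k), which are indexed by T.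
   The identity holds between coefficients, so that it can be applied to the
   form of (iii) as well as to evaluations at points z <> 0.

   From (iv) to a measure.  The functional extends, by M. Riesz, to a positive
   functional J on a space containing the bounded functions.  Dyadic squares,
   enumerated compatibly with refinement, receive the masses J(1_Q), and
   laying out successive intervals of these lengths on [0, J(1)[ defines, in
   the limit, a map to the plane; mu is the image of Lebesgue measure.
   Fatou's lemma gives int f <= J(f) for continuous f >= 0, with equality for
   f = 1 since J(|z|^2) controls the mass at infinity; applying this to
   C + delta v +- f, where v dominates f^2, gives int f = J(f).

   (vi) reduces to (v) by clearing denominators. *)

Set Implicit Arguments.
Unset Strict Implicit.
Unset Printing Implicit Defensive.

Import Order.TTheory GRing.Theory Num.Theory.
Import numFieldNormedType.Exports.

Local Open Scope classical_set_scope.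
Local Open Scope ring_scope.
Local Open Scope complex_scope.

(** * Extension of positive functionals *)

Section RieszExtension.
Variables (X : Type) (R : realType).

(* A positive partial functional is encoded by its graph; positivity makes the
   graph single-valued. *)
Definition positive_graph (G : set ((X -> R) * R)) : Prop :=
  (forall a u v, G u -> G v ->
     G (fun x => a * u.1 x + v.1 x, a * u.2 + v.2)) /\
  (forall u, G u -> (forall x, 0 <= u.1 x) -> 0 <= u.2).

Lemma positive_graph_le G u v : positive_graph G -> G u -> G v ->
  (forall x, u.1 x <= v.1 x) -> u.2 <= v.2.
Proof.
move=> [lin pos] Gu Gv uv.
have /pos /= := lin (-1) _ _ Gu Gv.
have -> : -1 * u.2 + v.2 = v.2 - u.2 by ring.
rewrite subr_ge0; apply=> x.
by rewrite mulN1r addrC subr_ge0.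
Qed.

(** The value [s] given to [f] is the supremum of the values of its minorants in [G], a set bounded
    above by the values of its majorants. [w1] makes this set nonempty and [w2] makes it bounded. *)
Lemma positive_graph_extend G f w1 w2 : positive_graph G ->
  G w1 -> G w2 -> (forall x, w1.1 x <= f x <= w2.1 x) ->
  exists s, positive_graph
    [set u | exists v a, [/\ G v, u.1 = (fun x => a * f x + v.1 x)
                           & u.2 = a * s + v.2]].
Proof.
move=> GP Gw1 Gw2 fw.
have [lin pos] := GP.
pose S := [set y | exists2 v, G v /\ (forall x, v.1 x <= f x) & v.2 = y].
have Sub w : G w -> (forall x, f x <= w.1 x) -> ubound S w.2.
  move=> Gw fle y [v [Gv vf] <-].
  by apply: (positive_graph_le GP Gv Gw) => x; exact: le_trans (vf x) (fle x).
have S0 : S !=set0.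
  by exists w1.2, w1 => //; split=> // x; case/andP: (fw x).
have hS : has_sup S.
  split=> //; exists w2.2; apply: Sub => // x; by case/andP: (fw x).
exists (sup S); split.
  move=> a u1 u2 [v1 [a1 [Gv1 e1 e1']]] [v2 [a2 [Gv2 e2 e2']]].
  exists (fun x => a * v1.1 x + v2.1 x, a * v1.2 + v2.2), (a * a1 + a2).
  split; first exact: lin.
    by rewrite /= e1 e2; apply/funext => x /=; ring.
  by rewrite /= e1' e2'; ring.
move=> u [v [a [Gv eu eu']]]; rewrite eu eu' => pu.
have Gz : G (fun x => 0, 0).
  have := lin (-1) _ _ Gv Gv.
  have -> : -1 * v.2 + v.2 = 0 by ring.
  by congr (G (_, _)); apply/funext => x; ring.
have scale b : G (fun x => b * v.1 x, b * v.2).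
  have := lin b _ _ Gv Gz; rewrite addr0.
  by congr (G (_, _)); apply/funext => x; rewrite addr0.
(* If [a < 0], nonnegativity of [a f + v] makes [v / (- a)] a majorant of [f]; if [a > 0], it makes
   [- v / a] a minorant. Each case compares [sup S] with a multiple of [v.2]. *)
have [a0|a0|a0] := ltgtP a 0.
- have : sup S <= (- a)^-1 * v.2.
    apply: ge_sup => //; apply: (Sub _ (scale _)) => x /=.
    rewrite mulrC ler_pdivlMr ?oppr_gt0//.
    by have := pu x; lra.
  rewrite mulrC ler_pdivlMr ?oppr_gt0//; lra.
- have : (- a^-1) * v.2 <= sup S.
    apply: ub_le_sup; first by case: hS.
    exists (fun x => (- a^-1) * v.1 x, (- a^-1) * v.2) => //; split=> //= x.
    rewrite mulNr -mulrN mulrC ler_pdivrMr//.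
    by have := pu x; lra.
  rewrite mulNr -mulrN mulrC ler_pdivrMr//; lra.
- rewrite a0 mul0r add0r; apply: pos => // x.
  by have := pu x; rewrite a0 mul0r add0r.
Qed.

Lemma riesz_extension (G0 : set ((X -> R) * R)) :
  positive_graph G0 -> G0 !=set0 ->
  exists G, [/\ positive_graph G, G0 `<=` G &
    forall f w1 w2, G w1 -> G w2 -> (forall x, w1.1 x <= f x <= w2.1 x) ->
      exists s, G (f, s)].
Proof.
move=> G0P [u0 G0u0].
(* Only inhabited graphs are asked to contain [G0], since the union of the empty chain is empty.
   Maximality then rules out the empty graph. *)
pose P G := positive_graph G /\ (forall u, G u -> G0 `<=` G).
have [F FP Ftot|G [[GP GG0] maxG]] := @Zorn_bigcup _ P.
  split; last by move=> u [A FA Au] v /(proj2 (FP _ FA) _ Au) Av; exists A.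
  split=> [a u v [A FA Au] [B FB Bv]|u [A FA Au]]; last first.
    exact: (proj2 (proj1 (FP _ FA))).
  have [AB|BA] := Ftot _ _ FA FB.
    by exists B => //; apply: (proj1 (proj1 (FP _ FB))) => //; exact: AB.
  by exists A => //; apply: (proj1 (proj1 (FP _ FA))) => //; exact: BA.
have G0G : G0 `<=` G.
  have [[u Gu]|Ge] := pselect (exists u, G u); first exact: GG0 Gu.
  exfalso; apply: (maxG G0); last by split=> // u _; exact: subset_refl.
  split; first by move=> u Gu; case: Ge; exists u.
  by move=> sub; case: Ge; exists u0; exact: sub.
exists G; split=> // f w1 w2 Gw1 Gw2 fw.
have [s Bs] := positive_graph_extend GP Gw1 Gw2 fw.
set B := (X in positive_graph X) in Bs.
have GB : G `<=` B.
  move=> u Gu; exists u, 0; split=> //; last by rewrite mul0r add0r.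
  by apply/funext => x; rewrite mul0r add0r.
have Bf : B (f, s).
  exists (fun x => -1 * w1.1 x + w1.1 x, -1 * w1.2 + w1.2), 1; split=> /=.
  - exact: (proj1 GP).
  - by apply/funext => x; ring.
  - by ring.
exists s; apply: contrapT => nG; apply: (maxG B).
  by split=> // BG; apply: nG; exact: BG.
by split=> // u _; exact: (subset_trans G0G GB).
Qed.

End RieszExtension.

(** * Dyadic codes *)

Section DyadicCode.
Variable R : realType.
Implicit Types (x y : R) (z : R[i]) (n : nat).

Lemma floor_doubleP x :
  exists b : bool, Num.floor (2 * x) = Num.floor x * 2 + b%:Z.
Proof.
have := ge_floor x; have := lt_succ_floor x; rewrite intrD.
have i2 : (Num.floor x * 2)%:~R = (Num.floor x)%:~R * 2 :> R by rewrite intrM.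
set m := Num.floor x in i2 *; move: i2; set u := m%:~R => i2 h2 h1.
have [xlt|xge] := ltP (2 * x) (m * 2 + 1)%:~R.
  exists false; apply: Num.Theory.floor_def; rewrite addr0 xlt i2 andbT.
  by rewrite mulrC ler_pM2l.
exists true; apply: Num.Theory.floor_def; rewrite xge/= !intrD i2.
by move: h2; rewrite -[1%:~R]/1 => h2; lra.
Qed.

Definition dyadic n x : int := Num.floor (2 ^+ n * x).

Lemma dyadic_close n x y : dyadic n x = dyadic n y -> `|x - y| <= 2^-1 ^+ n.
Proof.
rewrite /dyadic => e.
have p2 : 0 < 2 ^+ n :> R by rewrite exprn_gt0.
have : `|2 ^+ n * x - 2 ^+ n * y| <= 1.
  have := ge_floor (2 ^+ n * x); have := lt_succ_floor (2 ^+ n * x).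
  have := ge_floor (2 ^+ n * y); have := lt_succ_floor (2 ^+ n * y).
  by rewrite e intrD ler_norml; lra.
rewrite -mulrBr normrM (gtr0_norm p2) => h.
by rewrite exprVn -[leRHS]mul1r ler_pdivlMr// mulrC.
Qed.

(** Digit number n + 1 after the point in the binary expansion of the fractional part of [x]. *)
Definition dyadic_bit n x : bool := dyadic n.+1 x != dyadic n x * 2.

Lemma dyadicS n x : dyadic n.+1 x = dyadic n x * 2 + (dyadic_bit n x)%:Z.
Proof.
rewrite /dyadic_bit /dyadic exprS -mulrA.
have [b ->] := floor_doubleP (2 ^+ n * x).
by rewrite -[X in _ == X]addr0 (inj_eq (addrI _)); case: b.
Qed.

(* [code n z %/ 4 ^ n] numbers the unit square containing [z], and the last n
   base-4 digits locate a dyadic square of side 2^-n inside it. *)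
Fixpoint code n z : nat :=
  if n is m.+1 then
    (4 * code m z + 2 * dyadic_bit m (complex.Re z)
     + dyadic_bit m (complex.Im z))%N
  else pickle (dyadic 0 (complex.Re z), dyadic 0 (complex.Im z)).

(** Dropping the last base-4 digit passes to the enclosing square, so the four quarters of a square
    have consecutive codes. *)
Lemma codeS_div n z : (code n.+1 z %/ 4)%N = code n z.
Proof. by rewrite /=; case: dyadic_bit; case: dyadic_bit => /=; lia. Qed.

Lemma code_dyadic n z z' : code n z = code n z' ->
  dyadic n (complex.Re z) = dyadic n (complex.Re z') /\
  dyadic n (complex.Im z) = dyadic n (complex.Im z').
Proof.
elim: n => [|n ih] /= e.
  by case: (pcan_inj pickleK e).
rewrite !dyadicS.
have [|-> ->] := ih; first by move: e; do 4 case: dyadic_bit => /=; lia.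
by move: e; do 4 case: dyadic_bit => //=; lia.
Qed.

Lemma code_close n z z' : code n z = code n z' ->
  `|complex.Re z - complex.Re z'| <= 2^-1 ^+ n /\
  `|complex.Im z - complex.Im z'| <= 2^-1 ^+ n.
Proof. by move=> /code_dyadic[e1 e2]; split; exact: dyadic_close. Qed.

Lemma leq_bigmax2 p q (F : 'I_p -> 'I_q -> nat) i j :
  (F i j <= \max_i \max_j F i j)%N.
Proof. by apply: leq_trans (leq_bigmax i); exact: (leq_bigmax j). Qed.

(** A bounded box meets finitely many unit squares; this turns a bound on the coordinates into a
    bound on codes, as needed for tightness. *)
Lemma code0_bounded (K : nat) : exists j, forall z,
  `|complex.Re z| <= K%:R -> `|complex.Im z| <= K%:R -> (code 0 z < j)%N.
Proof.
(* The shifted indices run from -K-1 to K and so cover the floors of all reals of modulus at most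
   K. *)
pose F (i j : 'I_(K + K).+2) := pickle (i%:Z - K.+1%:Z, j%:Z - K.+1%:Z).
exists (\max_i \max_j F i j).+1 => z hx hy; rewrite ltnS /=.
have fl x : `|x| <= K%:R -> exists i : 'I_(K + K).+2, i%:Z - K.+1%:Z = dyadic 0 x.
  rewrite ler_norml /dyadic expr0 mul1r => /andP[x1 x2].
  have f1 : - K%:Z <= Num.floor x by rewrite floor_ge_int rmorphN.
  have f2 : Num.floor x <= K%:Z.
    by rewrite -(ler_int R) (le_trans (ge_floor _)).
  have lti : (`|(Num.floor x + K.+1%:Z)%R|%N < (K + K).+2)%N by lia.
  by exists (Ordinal lti) => /=; lia.
have [i <-] := fl _ hx; have [j <-] := fl _ hy.
exact: (leq_bigmax2 F).
Qed.

End DyadicCode.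

(** * The representing measure *)

(** The limit is the supremum of the numbers [u m - 2^-1 ^+ m]; comparing at the smaller of two
    indices shows that every [u n + 2^-1 ^+ n] bounds them above. *)
Lemma nested_limit (R : realType) (u : nat -> R) :
  (forall n m, (n <= m)%N -> `|u n - u m| <= 2^-1 ^+ n) ->
  exists l, forall n, `|l - u n| <= 2^-1 ^+ n.
Proof.
move=> hu.
have up n : ubound [set u m - 2^-1 ^+ m | m in setT] (u n + 2^-1 ^+ n).
  move=> _ [m _ <-].
  have p k : 0 <= 2^-1 ^+ k :> R by rewrite exprn_ge0// invr_ge0.
  have := p n; have := p m; have [/hu|/ltnW/hu] := leqP n m;
    rewrite ler_norml => /andP[h1 h2]; lra.
pose S := [set u m - 2^-1 ^+ m | m in setT].
have S0 : S !=set0 by exists (u 0 - 2^-1 ^+ 0), 0.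
exists (sup S) => n; rewrite ler_distl; apply/andP; split.
  by apply: ub_le_sup; [exists (u 0 + 2^-1 ^+ 0); exact: up|exists n].
by apply: ge_sup => //; exact: up.
Qed.

(** * Open sets, continuity and Borel measurability through coordinate boxes *)

Section Borel.
Variable R : realType.

Lemma exists_half_exp_le (e : R) : 0 < e -> exists n, 2^-1 ^+ n <= e.
Proof.
move=> e0; pose n := (Num.truncn e^-1).+1; exists n.
have en : e^-1 <= 2 ^+ n.
  apply: le_trans (ltW (truncnS_gt _)) _; rewrite -natrX ler_nat ltnW//.
  exact: ltn_expl.
by rewrite exprVn invf_ple// posrE exprn_gt0.
Qed.

Definition box (e : R) (w z : R[i]) : Prop :=
  `|complex.Re w - complex.Re z| <= e /\ `|complex.Im w - complex.Im z| <= e.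

Lemma norm_complex_le (z : R[i]) (e : R) :
  `|complex.Re z| <= e -> `|complex.Im z| <= e -> `|z| <= (2 * e)%:C.
Proof.
move=> h1 h2; rewrite [z]complexE.
have -> : (2 * e)%:C = e%:C + e%:C by rewrite mulr2n mulrDl mul1r rmorphD.
apply: le_trans (ler_normD _ _) _; apply: lerD.
  by rewrite normc_def/= expr0n/= addr0 sqrtr_sqr lecR.
rewrite normrM normc_def/= expr0n expr1n/= add0r sqrtr1 mul1r.
by rewrite normc_def/= expr0n/= addr0 sqrtr_sqr lecR.
Qed.

Lemma open_box (O : set (R[i])^o) w : open O -> O w ->
  exists2 e : R, 0 < e & forall z, box e w z -> O z.
Proof.
rewrite openE => oO /oO /nbhs_ballP[/= d d0 dO].
have dr : (complex.Re d)%:C = d by apply: RRe_real; exact: gtr0_real.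
have d0' : 0 < complex.Re d by rewrite -ltcR dr.
(* Two coordinate errors of a third of the radius give a distance of at most two thirds of it, which
   leaves the strict inequality that the ball requires. *)
exists (complex.Re d / 3); first by rewrite divr_gt0.
move=> z [h1 h2]; apply: dO; rewrite -ball_normE /ball_/=.
apply: le_lt_trans (@norm_complex_le (w - z) (complex.Re d / 3) _ _) _.
- by case: w z h1 h2 => [? ?] [? ?].
- by case: w z h1 h2 => [? ?] [? ?].
by rewrite -dr ltcR; lra.
Qed.

Lemma continuous_box (f : (R[i])^o -> R) w (e : R) : continuous f -> 0 < e ->
  exists2 d : R, 0 < d & forall z, box d w z -> `|f w - f z| < e.
Proof.
move=> /continuousP cf e0.
have [||d d0 hd] := @open_box (f @^-1` ball (f w) e) w.
- by apply: cf; exact: ball_open.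
- exact: ballxx.
by exists d => // z /hd; rewrite /= -ball_normE.
Qed.

Lemma measurable_continuous (f : (R[i])^o -> R) : continuous f ->
  measurable_fun [set: complexBorel R] (f : complexBorel R -> R).
Proof.
move=> /continuousP cf; apply: (measurability _ (RGenOpens.measurableE R)).
move=> _ [_ [a [b ->] <-]]; rewrite setTI; apply: sub_sigma_algebra.
exact/cf/interval_open.
Qed.

End Borel.

Lemma integral_mrestr d (T : measurableType d) (R : realType)
    (mu : {measure set T -> \bar R}) (E : set T) (mE : measurable E)
    (h : T -> \bar R) : measurable_fun setT h -> (forall t, 0 <= h t)%E ->
  (\int[mrestr mu mE]_t h t = \int[mrestr mu mE]_(t in E) h t)%E.
Proof.
move=> mh h0; have muC0 : mrestr mu mE (~` E) = 0%E.
  by rewrite /mrestr setICl measure0.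
rewrite -[in LHS](setUv E).
rewrite ge0_integral_setU ?setUv//; [|exact: measurableC|].
  rewrite [X in (_ + X)%E]null_set_integral ?adde0//; first exact: measurableC.
  exact: measurable_funTS.
by apply/disj_setPS; rewrite setICr.
Qed.

(** * The image of Lebesgue measure attached to a positive functional *)

Section QuantileCoupling.
Variables (R : realType) (D : set (R[i] -> R)) (J : (R[i] -> R) -> R).
Hypothesis D_lin : forall a f g, D f -> D g -> D (fun z => a * f z + g z).
Hypothesis J_lin : forall a f g, D f -> D g ->
  J (fun z => a * f z + g z) = a * J f + J g.
Hypothesis J_pos : forall f, D f -> (forall z, 0 <= f z) -> 0 <= J f.
Hypothesis D_bnd : forall f, (exists K : R, forall z, `|f z| <= K) -> D f.
Hypothesis D_sq : D (fun z => complex.Re z ^+ 2 + complex.Im z ^+ 2).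

Implicit Types (t : R) (z w : R[i]) (n m i j : nat) (f g : R[i] -> R).

Lemma D_ind (P : pred R[i]) : D (fun z => (P z)%:R).
Proof. by apply: D_bnd; exists 1 => z; case: (P z); rewrite ?normr0 ?normr1. Qed.

Lemma J_le f g : D f -> D g -> (forall z, f z <= g z) -> J f <= J g.
Proof.
move=> Df Dg fg; rewrite -subr_ge0.
have -> : J g - J f = J (fun z => -1 * f z + g z).
  by rewrite J_lin// mulN1r addrC.
apply: J_pos => [|z]; first exact: D_lin.
by rewrite mulN1r addrC subr_ge0.
Qed.

Lemma J0 : J (fun => 0) = 0.
Proof.
have D0 : D (fun => 0) by apply: D_bnd; exists 0 => z; rewrite normr0.
transitivity (-1 * J (fun => 0) + J (fun => 0)); last by rewrite mulN1r addNr.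
by rewrite -J_lin//; congr J; apply/funext => z; rewrite mulr0 addr0.
Qed.

Lemma JZ a f : D f -> J (fun z => a * f z) = a * J f.
Proof.
move=> Df; have D0 : D (fun => 0) by apply: D_bnd; exists 0 => z; rewrite normr0.
have := J_lin a Df D0; rewrite J0 addr0 => <-.
by congr J; apply/funext => z; rewrite addr0.
Qed.

Lemma DZ a f : D f -> D (fun z => a * f z).
Proof.
move=> Df; have D0 : D (fun => 0) by apply: D_bnd; exists 0 => z; rewrite normr0.
by have := D_lin a Df D0; congr D; apply/funext => z; rewrite addr0.
Qed.

Definition mass : R := J (fun => 1).

(** When the masses of the level-[n] squares are laid out from 0 in the order of their codes, this
    is the left endpoint of the interval of square [j]. *)
Definition cumul n j : R := J (fun z => (code n z < j)%N%:R).

Lemma cumul0 n : cumul n 0 = 0.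
Proof. by rewrite /cumul -[RHS]J0. Qed.

Lemma cumul_le n i j : (i <= j)%N -> cumul n i <= cumul n j.
Proof.
move=> ij; apply: J_le => [||z]; try exact: D_ind.
by rewrite ler_nat; have [h|//] := ltnP (code n z) i; rewrite (leq_trans h ij).
Qed.

Lemma cumul_mass n j : cumul n j <= mass.
Proof.
apply: J_le => [||z]; first exact: D_ind.
  exact: (D_ind xpredT).
by rewrite (ler_nat _ _ 1) leq_b1.
Qed.

(** The four quarters of a square have consecutive codes, so the subdivisions of the interval at
    successive levels refine each other. *)
Lemma cumul_refine n j : cumul n.+1 (4 * j) = cumul n j.
Proof.
congr J; apply/funext => z.
by rewrite -(codeS_div n z) ltn_divLR// mulnC.
Qed.

Lemma cumulS n j :
  cumul n j.+1 - cumul n j = J (fun z => (code n z == j)%:R).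
Proof.
transitivity (J (fun z => -1 * (code n z < j)%N%:R + (code n z < j.+1)%N%:R)).
  by rewrite J_lin; [rewrite mulN1r addrC|exact: D_ind|exact: D_ind].
congr J; apply/funext => z.
rewrite ltnS; case: (ltngtP (code n z) j) => _ /=;
  rewrite ?mulr1 ?addNr ?mulr0 ?add0r//.
Qed.

(** Chebyshev's inequality: the functional of |z|^2 bounds the mass outside a large box, so no mass
    escapes to infinity. Refinement reduces every level to level 0. *)
Lemma cumul_tight n t : t < mass -> exists j, t < cumul n j.
Proof.
move=> tm; have mt : 0 < mass - t by rewrite subr_gt0.
suff [j tj] : exists j, t < cumul 0 j.
  elim: n => [|n [i ti]]; first by exists j.
  by exists (4 * i)%N; rewrite cumul_refine.
set Q := J (fun z => complex.Re z ^+ 2 + complex.Im z ^+ 2).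
have Q0 : 0 <= Q by apply: J_pos => // z; rewrite addr_ge0 ?sqr_ge0.
(* A point outside the box of half-width K has |z|^2 >= K, because K >= 1. Hence the outer indicator
   is at most |z|^2 / K, and its mass is below [mass - t]. *)
pose K := (Num.truncn (Q / (mass - t))).+1.
have QK : Q / K%:R < mass - t.
  by rewrite ltr_pdivrMr ?ltr0n// mulrC -ltr_pdivrMr// truncnS_gt.
have [j hj] := code0_bounded R K; exists j.
suff : mass - cumul 0 j <= Q / K%:R by lra.
have -> : mass - cumul 0 j = J (fun z => -1 * (code 0 z < j)%N%:R + true%:R).
  rewrite J_lin; [by rewrite mulN1r addrC|exact: D_ind|exact: (D_ind xpredT)].
rewrite /Q mulrC -JZ//; apply: J_le => [||z].
- by apply: D_lin; [exact: D_ind|exact: (D_ind xpredT)].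
- exact: DZ.
have [//|jz] := ltnP (code 0 z) j.
  by rewrite mulr1 addNr mulr_ge0 ?invr_ge0// addr_ge0// sqr_ge0.
rewrite mulr0 add0r mulrC ler_pdivlMr ?ltr0n// mul1r leNgt.
apply/negP => lK.
have K1 : 1 <= K%:R :> R by rewrite ler1n.
have b (x : R) : x ^+ 2 < K%:R -> `|x| <= K%:R.
  move=> xK; rewrite leNgt; apply/negP => Kx.
  have : K%:R * 1 <= `|x| * `|x| by rewrite ler_pM//;
    [exact: ltW|exact: le_trans K1 (ltW Kx)].
  by rewrite mulr1 -normrM -expr2 ger0_norm ?sqr_ge0// leNgt xK.
suff : (code 0 z < j)%N by rewrite ltnNge jz.
apply: hj; apply: b; apply: le_lt_trans lK; first by rewrite lerDl sqr_ge0.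
by rewrite lerDr sqr_ge0.
Qed.

Definition quantile n t : nat := xget 0%N [set j | cumul n j <= t < cumul n j.+1].

Lemma quantileP n t : 0 <= t < mass ->
  cumul n (quantile n t) <= t < cumul n (quantile n t).+1.
Proof.
move=> /andP[t0 tm]; have [j tj] := cumul_tight n tm.
suff [i ti] : exists i, cumul n i <= t < cumul n i.+1.
  by have /= := @xgetPex _ 0%N [set j | cumul n j <= t < cumul n j.+1]
    (ex_intro _ i ti).
(* Starting from an endpoint beyond [t], the induction descends to the last endpoint that does not
   exceed [t]. *)
elim: j tj => [|j ih]; first by rewrite cumul0 ltNge t0.
have [/ih//|h1 h2] := ltP t (cumul n j).
by exists j; rewrite h1 h2.
Qed.

Lemma quantile_uniq n t j : cumul n j <= t < cumul n j.+1 -> quantile n t = j.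
Proof.
move=> jt; have /= : [set j | cumul n j <= t < cumul n j.+1] (quantile n t).
  by apply: (@xgetPex _ 0%N [set j | _]); exists j.
move: jt => /andP[h1 h2] /andP[h3 h4].
apply/eqP; rewrite eqn_leq; apply/andP; split; rewrite leqNgt; apply/negP.
  by move=> /(cumul_le n) h; have := lt_le_trans h2 (le_trans h h3); rewrite ltxx.
by move=> /(cumul_le n) h; have := lt_le_trans h4 (le_trans h h1); rewrite ltxx.
Qed.

Lemma quantile_div n t : 0 <= t < mass ->
  (quantile n.+1 t %/ 4)%N = quantile n t.
Proof.
move=> /(quantileP n.+1) /andP[h1 h2]; apply/esym/quantile_uniq.
rewrite -cumul_refine -[cumul n _]cumul_refine; apply/andP; split.
  by apply: le_trans h1; apply: cumul_le; rewrite mulnC leq_trunc_div.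
apply: lt_le_trans h2 _; apply: cumul_le.
by rewrite mulnC ltn_ceil.
Qed.

(** A code that no point carries has mass zero, so its interval is empty and cannot contain [t]. *)
Lemma quantile_cell n t : 0 <= t < mass -> exists z, code n z = quantile n t.
Proof.
move=> /(quantileP n); set j := quantile n t => tj.
apply: contrapT => nz; have := cumulS n j.
rewrite (_ : (fun z => _) = (fun => 0)) ?J0.
  by move: tj; lra.
by apply/funext => z; case: eqP => // zj; case: nz; exists z.
Qed.

Lemma quantile_nested n m t z : 0 <= t < mass -> (n <= m)%N ->
  code m z = quantile m t -> code n z = quantile n t.
Proof.
move=> ht /subnK <-; elim: (m - n)%N => // k ih e; apply: ih.
by rewrite -quantile_div// -addSn -e codeS_div.
Qed.

(** [w] is the point to which the nested squares attached to [t] shrink. It may lie on the boundary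
    of half-open squares, so closeness is asked instead of membership. *)
Definition coupling_spec t w := forall n z, code n z = quantile n t ->
  `|complex.Re w - complex.Re z| <= 2 * 2^-1 ^+ n /\
  `|complex.Im w - complex.Im z| <= 2 * 2^-1 ^+ n.

(** Points chosen in the successive squares have coordinates converging at rate 2^-n. The factor 2
    adds the distance from the limit to the chosen point and from there to any other point of the
    square. *)
Lemma coupling_exists t : 0 <= t < mass -> exists w, coupling_spec t w.
Proof.
move=> ht.
have [r hr] := @choice _ _ (fun n z => code n z = quantile n t)
  (fun n => quantile_cell n ht).
have close n m : (n <= m)%N -> code n (r n) = code n (r m).
  by move=> nm; rewrite hr (quantile_nested ht nm).
have [x hx] := @nested_limit _ (fun n => complex.Re (r n))
  (fun n m nm => proj1 (code_close (close _ _ nm))).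
have [y hy] := @nested_limit _ (fun n => complex.Im (r n))
  (fun n m nm => proj2 (code_close (close _ _ nm))).
exists (Complex x y) => n z zn /=.
have [c1 c2] := @code_close _ n (r n) z (etrans (hr n) (esym zn)).
have tri (a b c e : R) : `|a - b| <= e -> `|b - c| <= e -> `|a - c| <= 2 * e.
  by rewrite !ler_norml; lra.
by split; [apply: tri (hx n) c1|apply: tri (hy n) c2].
Qed.

Definition coupling t : R[i] := xget 0 [set w | coupling_spec t w].

Lemma couplingP t : 0 <= t < mass -> coupling_spec t (coupling t).
Proof.
move=> ht; have [w hw] := coupling_exists ht.
exact: (@xgetPex _ 0 [set w | coupling_spec t w] (ex_intro _ w hw)).
Qed.

Local Notation cell n j := `[cumul n j, cumul n j.+1[%classic.
Local Notation dom := `[0, mass[%classic.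

(** Extended by 0 to the whole line; the points outside [0, [mass][ are null for the restricted
    Lebesgue measure. *)
Definition total_coupling t : R[i] :=
  if 0 <= t < mass then coupling t else 0.

Lemma cell_quantile n j t : cell n j t ->
  0 <= t < mass /\ quantile n t = j.
Proof.
rewrite /= in_itv/= => tj; split; last exact: quantile_uniq tj.
case/andP: tj => h1 h2; rewrite (le_trans _ h1)/=.
  by rewrite (lt_le_trans h2)//; exact: cumul_mass.
by rewrite -(cumul0 n); exact: cumul_le.
Qed.

Lemma quantile_cell_in n t : 0 <= t < mass -> cell n (quantile n t) t.
Proof. by move=> ht; rewrite /= in_itv/=; exact: quantileP. Qed.

Lemma measurable_total_coupling :
  measurable_fun setT (total_coupling : measurableTypeR R -> complexBorel R).
Proof.
apply: (@measurability _ _ _ (complexBorel R) _ _ (@open (R[i])^o)) => //.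
move=> _ [U oU <-].
rewrite setTI.
(* The preimage of [U] is the countable union of the intervals whose square has a suitable
   neighbourhood inside [U], together with the exterior of the domain when 0 lies in [U]. *)
pose S n := [set j | exists2 z, code n z = j &
  forall w, box (2 * 2^-1 ^+ n) w z -> U w].
rewrite (_ : _ @^-1` _ =
    (\bigcup_n \bigcup_(j in S n) cell n j) `|`
    (~` dom `&` (fun=> U 0))); last first.
  apply/seteqP; split => t.
    rewrite /= /total_coupling in_itv/=; case: ifPn => [ht Ut|ht U0]; last first.
      by right; split=> //; exact/negP.
    left; have [e e0 he] := open_box oU Ut.
    (* The image of [t] and the point [w] are both within 2 * 2^-n of [z], hence within 4 * 2^-n of
       each other. *)
    have [n ne] : exists n, 2^-1 ^+ n <= e / 4.
      by apply: exists_half_exp_le; rewrite divr_gt0.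
    exists n => //; exists (quantile n t); last exact: quantile_cell_in.
    have [z hz] := quantile_cell n ht.
    exists z => // w [w1 w2]; apply: he.
    have [h1 h2] := couplingP ht hz.
    by split; move: w1 w2 h1 h2; rewrite !ler_norml; lra.
  move=> [[n _ [j [z zj hz]] /cell_quantile[ht tj]]|].
    rewrite /= /total_coupling ht; apply: hz.
    by apply: couplingP => //; rewrite zj tj.
  move=> [/= + U0]; rewrite /= /total_coupling in_itv/= => /negP/negbTE.
  by rewrite /mkset => ->.
apply: measurableU.
  apply: bigcup_measurable => n _; apply: bigcup_measurable => j _.
  exact: measurable_itv.
apply: measurableI; first by apply: measurableC; exact: measurable_itv.
have [U0|nU0] := pselect (U 0).
  by rewrite (_ : (fun => U 0) = setT)//; apply/seteqP; split.
by rewrite (_ : (fun => U 0) = set0)//; apply/seteqP; split.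
Qed.

Lemma measurable_dom : measurable (dom : set (measurableTypeR R)).
Proof. exact: measurable_itv. Qed.

Let leb : {measure set (measurableTypeR R) -> \bar R} := @lebesgue_measure R.
Let nu : set (measurableTypeR R) -> \bar R := mrestr leb measurable_dom.

Definition coupling_measure : {measure set (complexBorel R) -> \bar R}.
Proof.
unshelve refine [the measure _ _ of pushforward nu
  (total_coupling : measurableTypeR R -> complexBorel R)].
exact: measurable_total_coupling.
Defined.

Lemma mass_ge0 : 0 <= mass.
Proof. by apply: J_pos => //; exact: (D_ind xpredT). Qed.

Lemma coupling_measureT : coupling_measure setT = mass%:E.
Proof.
rewrite /= /pushforward/= preimage_setT /nu /mrestr setTI /leb.
rewrite lebesgue_measure_itv/= lte_fin; case: ltgtP mass_ge0 => // [_ _|<- _//].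
by rewrite -EFinD subr0.
Qed.

Lemma integral_coupling (h : R[i] -> \bar R) :
  measurable_fun [set: complexBorel R] h -> (forall z, 0 <= h z)%E ->
  (\int[coupling_measure]_z h z = \int[nu]_(t in dom) h (total_coupling t))%E.
Proof.
move=> mh h0; rewrite ge0_integral_pushforward//; last first.
  exact: measurable_total_coupling.
rewrite preimage_setT integral_mrestr// => [|t]; last exact: h0.
exact: measurableT_comp mh measurable_total_coupling.
Qed.

Lemma dom_bigcup_cell n : dom = \bigcup_j cell n j.
Proof.
apply/seteqP; split => [t ht|t [j _ /cell_quantile[ht _]]].
  exists (quantile n t) => //; apply: quantile_cell_in.
  by move: ht; rewrite /= in_itv.
by rewrite /= in_itv.
Qed.

Lemma trivIset_cell n : trivIset setT (fun j => cell n j).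
Proof.
by move=> i j _ _ [t [/cell_quantile[_ <-] /cell_quantile[_ <-]]].
Qed.

Lemma nu_cell n j : nu (cell n j) = (cumul n j.+1 - cumul n j)%:E.
Proof.
rewrite /nu /mrestr setIidl; last first.
  by rewrite (dom_bigcup_cell n) => t tj; exists j.
rewrite /leb/= lebesgue_measure_itv/= lte_fin.
case: ifPn => [_|]; first by rewrite EFinB.
by rewrite -leNgt => h; rewrite (le_anti (introT andP (conj h (cumul_le n
  (leqnSn j))))) subrr.
Qed.

Lemma measurable_quantile n (e : nat -> R) :
  measurable_fun dom (fun t : measurableTypeR R => (e (quantile n t))%:E).
Proof.
move=> _ B mB; rewrite (_ : _ `&` _ =
    \bigcup_(j in [set j | B (e j)%:E]) cell n j); last first.
  apply/seteqP; split => [t [ht Bt]|t [j Bj /cell_quantile[ht tj]]].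
    exists (quantile n t) => //; apply: quantile_cell_in.
    by move: ht; rewrite /= in_itv.
  by split; rewrite /= ?in_itv//= tj.
by apply: bigcup_measurable => j _; exact: measurable_itv.
Qed.

(** The value on square [j] of the level-[n] lower step function of [f]; for an empty square it is
    0, the default value of [inf]. *)
Definition cell_inf f n j : R := inf [set f z | z in [set z | code n z = j]].

Lemma cell_inf_ge0 f n j : (forall z, 0 <= f z) -> 0 <= cell_inf f n j.
Proof.
move=> f0; rewrite /cell_inf; set A := (X in inf X).
have [->|/set0P A0] := eqVneq A set0; first by rewrite inf0.
by apply: lb_le_inf => // _ [? _ <-].
Qed.

Lemma cell_inf_le f n z : (forall z, 0 <= f z) -> cell_inf f n (code n z) <= f z.
Proof.
move=> f0; apply: ge_inf; last by exists z.
by exists 0 => _ [? _ <-].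
Qed.

(** The integral is a series over the cells. Each partial sum is the value of [J] at a finite step
    function below [f], so only finite additivity and positivity of [J] are used. *)
Lemma integral_cell_inf f n : D f -> (forall z, 0 <= f z) ->
  (\int[nu]_(t in dom) (cell_inf f n (quantile n t))%:E <= (J f)%:E)%E.
Proof.
move=> Df f0; rewrite [X in integral _ X _](dom_bigcup_cell n).
rewrite ge0_integral_bigcup//; last 3 first.
- rewrite -dom_bigcup_cell; exact: measurable_quantile.
- by move=> t _; rewrite lee_fin cell_inf_ge0.
- exact: trivIset_cell.
have eqc j : (\int[nu]_(t in cell n j) (cell_inf f n (quantile n t))%:E =
    (cell_inf f n j * (cumul n j.+1 - cumul n j))%:E)%E.
  transitivity (\int[nu]_(t in cell n j) (cell_inf f n j)%:E)%E.
    by apply: eq_integral => t /set_mem /cell_quantile[_ ->].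
  rewrite (integral_cst nu); last exact: measurable_itv.
  by rewrite EFinM; congr (_ * _)%E; exact: nu_cell.
under eq_eseriesr do rewrite eqc.
apply: lime_le; first by apply: is_cvg_nneseries => j _ _; rewrite lee_fin
  mulr_ge0 ?cell_inf_ge0// subr_ge0 cumul_le.
apply: nearW => k; rewrite sumEFin lee_fin.
pose g k z := \sum_(0 <= j < k) cell_inf f n j * (code n z == j)%:R.
have [Dg Jg] : D (g k) /\ J (g k) =
    \sum_(0 <= j < k) cell_inf f n j * (cumul n j.+1 - cumul n j).
  elim: k => [|k [Dk Jk]].
    rewrite /g big_geq//; under eq_fun do rewrite big_geq//.
    split; last exact: J0.
    by apply: D_bnd; exists 0 => z; rewrite normr0.
  have eg : g k.+1 = fun z => cell_inf f n k * (code n z == k)%:R + g k z.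
    by apply/funext => z; rewrite /g big_nat_recr//= addrC.
  rewrite eg; split; first by apply: D_lin => //; exact: D_ind.
  rewrite J_lin//; last exact: D_ind.
  by rewrite Jk -cumulS big_nat_recr//= addrC.
rewrite -Jg; apply: J_le => // z.
rewrite /g; have [kz|kz] := ltnP (code n z) k; last first.
  rewrite big_nat big1 ?f0// => j /andP[_ jk].
  by rewrite gtn_eqF ?mulr0// (leq_trans jk).
rewrite (bigD1_seq (code n z)) ?mem_index_iota ?iota_uniq//= eqxx mulr1.
rewrite big1 ?addr0 ?cell_inf_le// => j jz.
by rewrite eq_sym (negbTE jz) mulr0.
Qed.

(** The squares attached to [t] shrink to its image, so by continuity the values of [f] on them, and
    their infima, approach the value there. *)
Lemma cell_inf_cvg f t : continuous (f : (R[i])^o -> R) -> (forall z, 0 <= f z) ->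
  0 <= t < mass ->
  (cell_inf f n (quantile n t))%:E @[n --> \oo] -->
    (f (total_coupling t))%:E.
Proof.
move=> cf f0 ht; apply: cvg_EFin; first exact: nearW.
apply/cvgrPdist_le => /= e e0.
rewrite /total_coupling ht; set w := coupling t.
have [d d0 hd] := continuous_box w cf e0.
have [N hN] : exists n, 2^-1 ^+ n <= d / 2.
  by apply: exists_half_exp_le; rewrite divr_gt0.
exists N => // n /= Nn.
have fz z : code n z = quantile n t -> `|f w - f z| < e.
  move=> zn; apply: hd.
  have nd : 2 * 2^-1 ^+ n <= d :> R.
    have : 2^-1 ^+ n <= 2^-1 ^+ N :> R.
      by rewrite ler_wiXn2l// ?invr_ge0// invf_le1// ler1n.
    by lra.
  have [h1 h2] := couplingP ht zn.
  by split; apply: le_trans nd.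
have [z0 hz0] := quantile_cell n ht.
rewrite ler_distlC; apply/andP; split.
  apply: lb_le_inf; first by exists (f z0), z0.
  by move=> _ [z zn <-]; move: (fz z zn); rewrite ltr_distlC; lra.
have := cell_inf_le n z0 f0; rewrite hz0 => h.
by apply: le_trans h _; move: (fz z0 hz0); rewrite ltr_distlC; lra.
Qed.

Lemma integral_coupling_le f : D f -> (forall z, 0 <= f z) ->
  continuous (f : (R[i])^o -> R) ->
  (\int[coupling_measure]_z (f z)%:E <= (J f)%:E)%E.
Proof.
move=> Df f0 cf; rewrite integral_coupling//; last first.
  exact: (proj2 (measurable_EFinP _ _) (measurable_continuous cf)).
pose F n (t : measurableTypeR R) := (cell_inf f n (quantile n t))%:E.
have -> : (\int[nu]_(t in dom) (f (total_coupling t))%:E =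
    \int[nu]_(t in dom) limn_einf (F ^~ t))%E.
  apply: eq_integral => t /set_mem/=; rewrite in_itv/= => ht.
  by have [-> _] := cvg_limn_einf_sup (cell_inf_cvg cf f0 ht).
apply: le_trans (@fatou _ _ _ nu _ measurable_dom F _ _) _.
- by move=> n; exact: measurable_quantile.
- by move=> n t _; rewrite lee_fin cell_inf_ge0.
rewrite limn_einf_lim; apply: lime_le; first exact: is_cvg_einfs.
apply: nearW => n; apply: le_trans (integral_cell_inf n Df f0).
by apply: ereal_inf_lbound; exists n => /=.
Qed.

End QuantileCoupling.

(** * A measure whose integrals agree with a positive functional *)

Section RepresentingMeasure.
Variable R : realType.

(** Multiplied by [d], the difference is the square of d|x| - 1/2. The free parameter lets a
    function be absorbed by a constant plus a small multiple of its square. *)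
Lemma amgm_le (d x : R) : 0 < d -> `|x| <= (4 * d)^-1 + d * x ^+ 2.
Proof.
move=> d0; have e : d * (4 * d)^-1 = 4^-1 by rewrite invfM mulrCA mulfV
  ?mulr1// gt_eqF.
rewrite -subr_ge0 -(pmulr_rge0 _ d0).
have -> : d * ((4 * d)^-1 + d * x ^+ 2 - `|x|) = (d * `|x| - 2^-1) ^+ 2.
  by rewrite mulrBr mulrDr e -(real_normK (num_real x)) //; field.
exact: sqr_ge0.
Qed.

Lemma representing_measure (G0 : set ((R[i] -> R) * R)) (c1 cs : R) :
  positive_graph G0 ->
  (forall u, G0 u -> continuous (u.1 : (R[i])^o -> R)) ->
  (forall u, G0 u -> exists2 v, G0 v & forall z, u.1 z ^+ 2 <= v.1 z) ->
  G0 (fun => 1, c1) ->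
  G0 (fun z => complex.Re z ^+ 2 + complex.Im z ^+ 2, cs) ->
  exists mu : {measure set (complexBorel R) -> \bar R}, forall u, G0 u ->
    mu.-integrable [set: complexBorel R] (fun z => (u.1 z)%:E) /\
    Rintegral mu [set: complexBorel R] u.1 = u.2.
Proof.
move=> G0P cG0 dG0 G01 G0s.
have [|G [GP G0G Gdom]] := riesz_extension G0P; first by exists (fun => 1, c1).
pose D : set (R[i] -> R) := [set f | exists s, G (f, s)].
pose J (f : R[i] -> R) := xget 0 [set s | G (f, s)].
have GJ f : D f -> G (f, J f) by move=> Df; exact: (@xgetPex _ 0 [set s | G (f,
  s)] Df).
have Guniq f s t : G (f, s) -> G (f, t) -> s = t.
  move=> Gs Gt; apply/le_anti/andP; split.
    exact: (positive_graph_le GP Gs Gt (fun=> lexx _)).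
  exact: (positive_graph_le GP Gt Gs (fun=> lexx _)).
have JE f s : G (f, s) -> J f = s.
  by move=> Gs; exact: (Guniq _ _ _ (GJ _ (ex_intro _ s Gs)) Gs).
have G_lin a f g : D f -> D g -> G (fun z => a * f z + g z, a * J f + J g).
  by move=> /GJ Df /GJ Dg; exact: (proj1 GP a _ _ Df Dg).
have D_lin a f g : D f -> D g -> D (fun z => a * f z + g z).
  by move=> Df Dg; eexists; exact: G_lin.
have J_lin a f g : D f -> D g -> J (fun z => a * f z + g z) = a * J f + J g.
  by move=> Df Dg; apply: JE; exact: G_lin.
have J_pos f : D f -> (forall z, 0 <= f z) -> 0 <= J f.
  by move=> /GJ Df f0; exact: (proj2 GP _ Df).
have D_G0 u : G0 u -> D u.1 by move=> Gu; exists u.2; apply: G0G; case: u Gu.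
have J_G0 u : G0 u -> J u.1 = u.2 by move=> Gu; apply: JE; apply: G0G; case: u Gu.
have D1 := D_G0 _ G01; have Ds := D_G0 _ G0s.
have D0 : D (fun => 0).
  have := D_lin (-1) _ _ D1 D1; congr D; apply/funext => z /=; lra.
have DZ a f : D f -> D (fun z => a * f z).
  by move=> Df; have := D_lin a _ _ Df D0; congr D; apply/funext => z;
    rewrite addr0.
have D_bnd f : (exists K : R, forall z, `|f z| <= K) -> D f.
  move=> [K fK]; apply: (Gdom f (_, _) (_, _)).
  - by apply: GJ; exact: (DZ (- K) _ D1).
  - by apply: GJ; exact: (DZ K _ D1).
  - by move=> z /=; rewrite !mulr1 -ler_norml.
pose mu := coupling_measure D_lin J_lin J_pos D_bnd Ds.
have muT : mu setT = c1%:E.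
  by rewrite /mu coupling_measureT /mass [J _](J_G0 _ G01).
have mu_le f : D f -> (forall z, 0 <= f z) -> continuous (f : (R[i])^o -> R) ->
  (\int[mu]_z (f z)%:E <= (J f)%:E)%E by exact: integral_coupling_le.
exists mu.
have mf u : G0 u -> measurable_fun [set: complexBorel R] (fun z => (u.1 z)%:E).
  by move=> /cG0 cu; exact: (proj2 (measurable_EFinP _ _)
    (measurable_continuous cu)).
have int_pos v : G0 v -> (forall z, 0 <= v.1 z) ->
    mu.-integrable [set: complexBorel R] (fun z => (v.1 z)%:E).
  move=> Gv v0; apply/integrableP; split; first exact: mf.
  under eq_integral do rewrite gee0_abs ?lee_fin//.
  by apply: le_lt_trans (mu_le _ (D_G0 _ Gv) v0 (cG0 _ Gv)) _; rewrite ltry.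
have int_G0 u : G0 u ->
    mu.-integrable [set: complexBorel R] (fun z => (u.1 z)%:E).
  move=> Gu; have [v Gv uv] := dG0 _ Gu.
  have v0 z : 0 <= v.1 z by apply: le_trans (uv z); exact: sqr_ge0.
  have Gw := proj1 G0P 1 _ _ G01 Gv.
  apply: le_integrable (int_pos _ Gw _) => //.
  - exact: mf.
  - move=> z _ /=; rewrite lee_fin mulr1 [leRHS]ger0_norm; last by rewrite addr_ge0.
    apply: le_trans (@amgm_le 1 (u.1 z) ltr01) _.
    by rewrite mul1r; apply: lerD => //; rewrite mulr1 invf_le1// ler1n.
  - by move=> z /=; rewrite mulr1 addr_ge0.
have Rint_le v : G0 v -> (forall z, 0 <= v.1 z) ->
    Rintegral mu [set: complexBorel R] v.1 <= v.2.
  move=> Gv v0; rewrite -lee_fin -(J_G0 _ Gv) fineK.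
    exact: (mu_le _ (D_G0 _ Gv) v0 (cG0 _ Gv)).
  exact: integrable_fin_num (int_pos _ Gv v0).
have Rint1 : Rintegral mu [set: complexBorel R] (fun => 1) = c1.
  by rewrite Rintegral_cst// muT mul1r.
have Rint_lin a u v : G0 u -> G0 v ->
  Rintegral mu [set: complexBorel R] (fun z => a * u.1 z + v.1 z) =
  a * Rintegral mu [set: complexBorel R] u.1 + Rintegral mu [set: complexBorel
    R] v.1.
  move=> Gu Gv; rewrite RintegralD//; [|by apply: (integrableZl measurableT a
    (int_G0 _ Gu))|exact: int_G0].
  by rewrite RintegralZl//; exact: int_G0.
have one_side u : G0 u -> Rintegral mu [set: complexBorel R] u.1 <= u.2.
  move=> Gu; have [v Gv uv] := dG0 _ Gu.
  have v0 z : 0 <= v.1 z by apply: le_trans (uv z); exact: sqr_ge0.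
  have v20 : 0 <= v.2 by exact: (proj2 G0P).
  have Ev0 : 0 <= Rintegral mu [set: complexBorel R] v.1 by apply: Rintegral_ge0.
  apply/ler_addgt0Pr => e e0.
  (* The function (4d)^-1 + d v + u is nonnegative, so [Rint_le] applies to it. Constants integrate
     exactly and cancel, and this [d] keeps the error [d * v.2] below [e]; the added 1 covers
     [v.2 = 0]. *)
  pose d := e / (v.2 + 1).
  have d0 : 0 < d by rewrite divr_gt0// ltr_wpDl.
  have G2 := proj1 G0P d _ _ Gv Gu.
  have G3 := proj1 G0P (4 * d)^-1 _ _ G01 G2.
  have /= := Rint_le _ G3.
  rewrite (Rint_lin _ _ _ G01 G2) (Rint_lin _ _ _ Gv Gu) Rint1 => h.
  have dv : d * v.2 <= e.
    rewrite /d mulrAC ler_pdivrMr ?ltr_wpDl// ler_pM2l//; lra.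
  suff : (4 * d)^-1 * c1 + (d * Rintegral mu [set: complexBorel R] v.1
     + Rintegral mu [set: complexBorel R] u.1) <= (4 * d)^-1 * c1 + (d * v.2 + u.2).
    have : 0 <= d * Rintegral mu [set: complexBorel R]
      v.1 by rewrite mulr_ge0// ltW.
    lra.
  apply: h => z; rewrite mulr1.
  have := amgm_le (u.1 z) d0; rewrite ler_norml => /andP[h _].
  have := ler_wpM2l (ltW d0) (uv z); lra.
move=> u Gu; split; first exact: int_G0.
apply/eqP; rewrite eq_le one_side//=.
have Gz := proj1 G0P (-1) _ _ Gu Gu.
(* -2u + u is -u, and the one-sided bound for it is the reverse inequality for [u]. *)
have Gn := proj1 G0P (-2) _ _ Gu Gu.
have /= := one_side _ Gn; rewrite Rint_lin//; lra.
Qed.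

End RepresentingMeasure.

(** * Positive polynomials and roots of unity *)

Section PositivePoly.
Variable C : numClosedFieldType.
Implicit Types (f g P : {poly C}) (x a : C).

Local Notation "f ^*p" := (map_poly Num.conj f) (at level 2, format "f ^*p").

(** The two polynomials agree at all natural numbers, more points than the degree of their
    difference allows. *)
Lemma conj_poly_id f :
  (forall x, x \is Num.real -> f.[x] \is Num.real) -> f^*p = f.
Proof.
move=> fr; apply/eqP; rewrite -subr_eq0; apply/eqP.
set g := _ - _.
apply: (@roots_geq_poly_eq0 _ g [seq i%:R | i <- iota 0 (size g)]).
- apply/allP => _ /mapP[i _ ->]; rewrite rootE /g hornerD hornerN.
  rewrite -{1}(conjC_nat C i) horner_map/= (CrealP _) ?subrr//.
  exact/fr/realn.
- rewrite map_inj_uniq ?iota_uniq// => i j /eqP.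
  by rewrite eqr_nat => /eqP.
- by rewrite size_map size_iota.
Qed.

(** Strict positivity excludes real roots, and [f] is its own conjugate, so a root [a] occurs
    together with its conjugate. Removing both divides [f] by |x - a|^2 > 0 on the real line, which
    preserves positivity; one of the two linear factors goes into [P]. *)
Lemma positive_poly_eq_mul_conj f :
  (forall x, x \is Num.real -> 0 < f.[x]) -> exists P, f = P * P^*p.
Proof.
have [n] := ubnP (size f); elim: n f => // n ih f szf f0.
have fK : f^*p = f by apply: conj_poly_id => x /f0; exact: gtr0_real.
have [/eqP/size_poly1P[c c0 fc]|sz1] := eqVneq (size f) 1%N.
  have c_ge0 : 0 < c by have := f0 0 (real0 _); rewrite fc hornerC.
  exists (sqrtC c)%:P; rewrite map_polyC/= -polyCM (CrealP _).
    by rewrite -expr2 sqrtCK.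
  by rewrite ger0_real// sqrtC_ge0 ltW.
have /closed_rootP[a ra] := sz1.
have aNreal : a \isn't Num.real.
  by apply: contraTN ra => /f0 h; rewrite rootE gt_eqF.
have [f1 f1E] : exists q, f = q * ('X - a%:P) by exact/factor_theorem.
have rca : root f (Num.conj a).
  by move: ra; rewrite !rootE -{2}fK horner_map/= fmorph_eq0.
have ca : Num.conj a - a != 0 by rewrite subr_eq0;
  apply: contra aNreal => /eqP/CrealP.
have [g gE] : exists q, f1 = q * ('X - (Num.conj a)%:P).
  apply/factor_theorem; move: rca; rewrite f1E rootM root_XsubC.
  by rewrite -subr_eq0 (negbTE ca) orbF.
have fE : f = g * (('X - a%:P) * ('X - (Num.conj a)%:P)).
  by rewrite f1E gE -mulrA; congr (_ * _); rewrite mulrC.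
have fn0 : f != 0 by apply: contraTneq (f0 0 (real0 _)) => ->; rewrite horner0 ltxx.
have [|x xr|P gP] := ih g.
- rewrite -ltnS (leq_trans _ szf)// ltnS fE.
  have gn0 : g != 0 by apply: contraNneq fn0 => g0; rewrite fE g0 mul0r.
  rewrite size_proper_mul ?size_XsubC; last first.
    by rewrite lead_coefM !lead_coefXsubC !mulr1 lead_coef_eq0.
  by rewrite size_Mmonic ?monicXsubC ?polyXsubC_eq0// !size_XsubC; lia.
- have := f0 x xr; rewrite fE !hornerM !hornerXsubC.
  rewrite -{3}(CrealP xr) -rmorphB -normCK pmulr_lgt0// exprn_gt0// normr_gt0.
  by rewrite subr_eq0; apply: contraNneq aNreal => <-.
exists (P * ('X - a%:P)).
by rewrite rmorphM/= map_polyXsubC fE gP; ring.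
Qed.

End PositivePoly.

Section RootsOfUnity.
Variable C : numClosedFieldType.

Lemma prim_root_exists M : (M > 0)%N -> exists z : C, M.-primitive_root z.
Proof.
move=> M0; pose p : {poly C} := 'X^M - 1.
have [r Dp] := closed_field_poly_normal p.
rewrite (monicP _) ?monicXnsubC // scale1r in Dp.
have rn1: all M.-unity_root r by apply/allP=> z; rewrite -root_prod_XsubC -Dp.
have sz_r: (M < (size r).+1)%N.
  by rewrite -(size_prod_XsubC r id) -Dp size_XnsubC.
have [|z] := hasP (has_prim_root M0 rn1 _ sz_r); last by exists z.
by rewrite -separable_prod_XsubC -Dp separable_Xn_sub_1 // pnatr_eq0 -lt0n.
Qed.

(* Quadrature on the unit circle, exact for Laurent polynomials of degree
   less than [M]. *)
Lemma circle_nodes M : (M > 0)%N -> exists w : 'I_M -> C,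
  (forall j, `|w j| = 1) /\
  forall l : int, (`|l| < M)%N -> \sum_j w j ^ l = if l == 0 then M%:R else 0.
Proof.
move=> M0; have [z zprim] := prim_root_exists M0.
have zM := prim_expr_order zprim.
have z1 : `|z| = 1.
  apply/eqP; rewrite -(@pexpr_eq1 _ _ M)// -normrX zM normr1//.
have zu : z != 0 by rewrite -normr_eq0 z1 oner_eq0.
exists (fun j : 'I_M => z ^+ j); split=> [j|l lM].
  by rewrite normrX z1 expr1n.
have [->|l0] := eqVneq l 0.
  under eq_bigr do rewrite expr0z.
  by rewrite sumr_const card_ord.
have zl : z ^ l != 1.
  case: l l0 lM => n l0 lM; rewrite ?NegzE -?exprnP -?exprnN ?invr_eq1.
    rewrite -(prim_order_dvd zprim) gtnNdvd// lt0n.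
    by move: l0.
  by rewrite -(prim_order_dvd zprim) gtnNdvd.
under eq_bigr => j _.
  rewrite exprnP exprzAC -exprnP; over.
have := subrX1 (z ^ l) M.
rewrite [X in X - 1](_ : _ = 1); last first.
  by rewrite !exprnP exprzAC -[z ^ M]exprnP zM exp1rz.
rewrite subrr => /esym/eqP; rewrite mulf_eq0 subr_eq0 (negbTE zl)/= => /eqP.
exact.
Qed.

End RootsOfUnity.

(** * Sums of hermitian squares in polar coordinates *)

Section GramCone.
Variable C : numClosedFieldType.
Implicit Types (F : int * int -> C) (s : seq ((int * int) * C)).

(* A finite list of pairs (exponent, coefficient) stands for a formal sum [q];
   [gram F q] is the image of |q|^2 under the linear form sending the monomial of
   exponent [k] to [F k]. *)
Definition gram F s : C :=
  \sum_(x <- s) \sum_(y <- s)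
    F (x.1.1 + y.1.2, x.1.2 + y.1.1) * x.2 * Num.conj y.2.

(** Sums of squares kept as identities in an arbitrary [F]: at a system as in (iii) they give values
    of its form, at the monomials in a point z <> 0 they give sums of |q|^2. *)
Definition gram_cone (Phi : (int * int -> C) -> C) : Prop :=
  exists L : seq (seq ((int * int) * C)),
    (forall s, s \in L -> forall x, x \in s -> 0 <= x.1.1 + x.1.2) /\
    forall F, Phi F = \sum_(s <- L) gram F s.

Lemma gram_cone_ext Phi Psi : (forall F, Phi F = Psi F) ->
  gram_cone Phi -> gram_cone Psi.
Proof. by move=> e [L [h1 h2]]; exists L; split=> // F; rewrite -e. Qed.

Lemma gram_coneD Phi Psi : gram_cone Phi -> gram_cone Psi ->
  gram_cone (fun F => Phi F + Psi F).
Proof.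
move=> [L [L1 L2]] [K [K1 K2]]; exists (L ++ K); split.
  by move=> s; rewrite mem_cat => /orP[/L1|/K1].
by move=> F; rewrite big_cat L2 K2.
Qed.

Lemma gram_cone0 : gram_cone (fun=> 0).
Proof. by exists [::]; split=> // F; rewrite big_nil. Qed.

Lemma gram_cone_sum (I : Type) (r : seq I) (Phi : I -> (int * int -> C) -> C) :
  (forall i, gram_cone (Phi i)) -> gram_cone (fun F => \sum_(i <- r) Phi i F).
Proof.
move=> hP; elim: r => [|i r ih].
  by apply: gram_cone_ext gram_cone0 => F; rewrite big_nil.
by apply: gram_cone_ext (gram_coneD (hP i) ih) => F; rewrite big_cons.
Qed.

Lemma gram_coneZ c Phi : 0 <= c -> gram_cone Phi ->
  gram_cone (fun F => c * Phi F).
Proof.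
move=> c0 [L [L1 L2]].
pose sc s := [seq (x.1, sqrtC c * x.2) | x : (int * int) * C <- s].
exists (map sc L); split.
  by move=> _ /mapP[s sL ->] _ /mapP[x xs ->]; exact: L1 sL _ xs.
move=> F; rewrite L2 big_map mulr_sumr; apply: eq_bigr => s _.
rewrite /gram big_map mulr_sumr; apply: eq_bigr => x _.
rewrite big_map mulr_sumr; apply: eq_bigr => y _ /=.
have rc : Num.conj (sqrtC c) = sqrtC c.
  by apply/CrealP/ger0_real; rewrite sqrtC_ge0.
by rewrite rmorphM/= rc -[c in LHS]sqrtCK; ring.
Qed.

Lemma gram_cone_gram s : (forall x, x \in s -> 0 <= x.1.1 + x.1.2) ->
  gram_cone (gram^~ s).
Proof.
move=> hs; exists [:: s]; split; last by move=> F; rewrite big_seq1.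
by move=> t; rewrite inE => /eqP ->.
Qed.

(* In polar coordinates z^m zbar^n = r^(m+n) e^(i(m-n)theta); the exponents
   (k, l) of r and e^(i theta) that arise are those with k + l even. *)
Definition polar F (k l : int) : C :=
  if (2 %| k + l)%Z then F (((k + l) %/ 2)%Z, k - ((k + l) %/ 2)%Z) else 0.

Lemma polarE F (m n : nat) :
  polar F (m%:Z + n%:Z) (m%:Z - n%:Z) = F (m%:Z, n%:Z).
Proof.
rewrite /polar; have -> : m%:Z + n%:Z + (m%:Z - n%:Z) = m%:Z * 2 by ring.
rewrite dvdz_mull// mulzK//; congr F; congr (_, _); ring.
Qed.

(** The pair (a, s) receives an exponent of total degree a >= 0 whose first component is (a + s)/2
    rounded up. For equal parities the two roundings cancel in the product with (b, t); for unequal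
    ones the polar term vanishes. *)
Lemma polar_pair F (a b s t : nat) :
  polar F (a%:Z + b%:Z) (s%:Z - t%:Z) =
  if odd (a + s) == odd (b + t) then
    F ((uphalf (a + s))%:Z + (b%:Z - (uphalf (b + t))%:Z),
       a%:Z - (uphalf (a + s))%:Z + (uphalf (b + t))%:Z)
  else 0.
Proof.
have e1 := odd_double_half (a + s); have e2 := odd_double_half (b + t).
rewrite !uphalf_half /polar; set u := (a + s)./2 in e1 *;
  set v := (b + t)./2 in e2 *.
case: eqP => [e|e].
  have -> : a%:Z + b%:Z + (s%:Z - t%:Z) =
      ((odd (a + s) + u)%:Z + (b%:Z - (odd (b + t) + v)%:Z)) * 2.
    by rewrite e in e1 *; lia.
  rewrite dvdz_mull// mulzK//; congr F; congr (_, _); lia.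
case: ifP => // /dvdzP[q hq]; exfalso.
by case: (odd _) (odd _) e e1 e2 => [] [] //; lia.
Qed.

(** Terms with a + e even and terms with a + e odd form two separate squares, since the mixed
    products have polar value 0. *)
Lemma gram_cone_polar A h (lam : nat -> nat -> C) :
  gram_cone (fun F => \sum_(a < A) \sum_(e < h) \sum_(b < A) \sum_(t < h)
    polar F (a%:Z + b%:Z) (e%:Z - t%:Z) * lam a e * Num.conj (lam b t)).
Proof.
pose S (par : bool) := [seq (((uphalf (a + e))%:Z, a%:Z - (uphalf (a + e))%:Z),
   (odd (a + e) == par)%:R * lam a e) | a <- index_iota 0 A, e <- index_iota 0 h].
exists [:: S false; S true]; split.
  move=> q; rewrite !inE => /orP[] /eqP -> _ /allpairsP[[a e] /= [_ _ ->]] /=; lia.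
have bS par (G : (int * int) * C -> C) : \sum_(x <- S par) G x =
    \sum_(a < A) \sum_(e < h) G (((uphalf (a + e))%:Z,
      a%:Z - (uphalf (a + e))%:Z), (odd (a + e) == par)%:R * lam a e).
  rewrite big_allpairs_dep/= big_mkord; apply: eq_bigr => a _.
  by rewrite big_mkord.
move=> F; rewrite big_cons big_seq1 /gram !bS -big_split/=.
apply: eq_bigr => a _; rewrite -big_split/=; apply: eq_bigr => e _.
rewrite !bS -big_split/=; apply: eq_bigr => b _.
rewrite -big_split/=; apply: eq_bigr => t _.
rewrite polar_pair !rmorphM/= !conjC_nat.
by case: (odd (a + e)); case: (odd (b + t)) => /=; ring.
Qed.

End GramCone.

(** * Linear functionals on univariate polynomials, given on powers of X *)

Section CoefFunctional.
Variables (C : numClosedFieldType) (G : nat -> C).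
Implicit Types f P : {poly C}.

Definition coef_lin f : C := \sum_(k < size f) f`_k * G k.

Lemma coef_lin_wide N f : (size f <= N)%N -> coef_lin f = \sum_(k < N) f`_k * G k.
Proof.
move=> fN; rewrite /coef_lin (big_ord_widen N (fun k => f`_k * G k))//.
rewrite big_mkcond/=; apply: eq_bigr => k _.
by case: ltnP => // fk; rewrite nth_default ?mul0r.
Qed.

Lemma coef_linD f g : coef_lin (f + g) = coef_lin f + coef_lin g.
Proof.
pose N := maxn (size f) (size g).
rewrite !(@coef_lin_wide N) ?leq_maxl ?leq_maxr ?size_polyD//.
by rewrite -big_split; apply: eq_bigr => k _; rewrite coefD mulrDl.
Qed.

Lemma coef_lin0 : coef_lin 0 = 0.
Proof. by rewrite /coef_lin size_poly0 big_ord0. Qed.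

Lemma coef_lin_sum (I : Type) (r : seq I) (f : I -> {poly C}) :
  coef_lin (\sum_(i <- r) f i) = \sum_(i <- r) coef_lin (f i).
Proof. exact: (big_morph coef_lin coef_linD coef_lin0). Qed.

Lemma coef_linZX a k : coef_lin (a *: 'X^k) = a * G k.
Proof.
rewrite (@coef_lin_wide k.+1); last first.
  by rewrite (leq_trans (size_scale_leq _ _))// size_polyXn.
rewrite (bigD1 ord_max)//= coefZ coefXn eqxx mulr1 big1 ?addr0// => i ik.
by rewrite coefZ coefXn (_ : (i : nat) == k = false) ?mulr0 ?mul0r//; apply/negbTE.
Qed.

Lemma coef_linC a : coef_lin a%:P = a * G 0%N.
Proof. by rewrite -coef_linZX expr0 alg_polyC. Qed.

Lemma poly_wide N P : (size P <= N)%N -> P = \sum_(a < N) P`_a *: 'X^a.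
Proof.
move=> PN; rewrite -poly_def; apply/polyP => k; rewrite coef_poly.
by case: ltnP => // Nk; rewrite nth_default// (leq_trans PN).
Qed.

Lemma coef_lin_mul_conj N P : (size P <= N)%N ->
  coef_lin (P * map_poly Num.conj P) =
  \sum_(a < N) \sum_(b < N) P`_a * Num.conj P`_b * G (a + b)%N.
Proof.
move=> PN.
have PN' : (size (map_poly Num.conj P) <= N)%N by rewrite size_map_poly.
rewrite {1}(poly_wide PN) (poly_wide PN') big_distrlr/= coef_lin_sum.
apply: eq_bigr => a _; rewrite coef_lin_sum; apply: eq_bigr => b _.
by rewrite -scalerAl -scalerAr scalerA -exprD coef_map/= coef_linZX.
Qed.

End CoefFunctional.

(** The multiplicity h - |l| counts the pairs with difference [l]; after division by [h] it is the
    Fejer weight. *)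
Lemma sum_diag_shift (V : nmodType) (h : nat) (l : int) (x : V) : (`|l| <= h)%N ->
  \sum_(s < h) \sum_(t < h) (if s%:Z - t%:Z == l then x else 0) = x *+ (h - `|l|).
Proof.
move=> lh; have count d : (d <= h)%N ->
    \sum_(s < h) \sum_(t < h) (if (s == t + d :> nat)%N then x else 0) = x *+
      (h - d).
  move=> dh; rewrite exchange_big/=.
  under eq_bigr => t _.
    rewrite (_ : \sum_(i < h) _ = if (t < h - d)%N then x else 0); last first.
      case: ltnP => [tl|tl].
        have ltd : (t + d < h)%N by lia.
        rewrite (bigD1 (Ordinal ltd))//= eqxx big1 ?addr0// => i ne.
        by case: eqP => // e; case/eqP: ne; exact: val_inj.
      rewrite big1// => i _; case: eqP => // e; have := ltn_ord i; lia.
    over.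
  rewrite -big_mkcond/= -(big_ord_widen h (fun=> x)) ?leq_subr//.
  by rewrite sumr_const card_ord.
case: l lh => d dh.
  rewrite -(count d)//; apply: eq_bigr => s _; apply: eq_bigr => t _.
  by congr (if _ then _ else _); apply/eqP/eqP; lia.
rewrite -(count d.+1)// exchange_big/=; apply: eq_bigr => s _;
  apply: eq_bigr => t _.
by rewrite NegzE; congr (if _ then _ else _); apply/eqP/eqP; lia.
Qed.

(** * Fejer averaging and the sum-of-squares certificate *)

Section Certificate.
Variables (C : numClosedFieldType) (B : nat) (p : nat -> nat -> C).
Hypothesis p_ge0 : forall z : C,
  0 <= \sum_(m < B) \sum_(n < B) p m n * (z ^+ m * Num.conj z ^+ n).

(** For |w| = 1 the conjugate of w is its inverse, and this is the restriction of p to the line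
    through 0 and [w], in the real coordinate along it. *)
Definition line_poly (w : C) : {poly C} :=
  \sum_(m < B) \sum_(n < B) (p m n * w ^ (m%:Z - n%:Z)) *: 'X^(m + n).

Lemma horner_line_poly w x : `|w| = 1 -> x \is Num.real -> 0 <= (line_poly w).[x].
Proof.
move=> w1 xr; have wN0 : w != 0 by rewrite -normr_eq0 w1 oner_eq0.
have wc : Num.conj w = w^-1 by rewrite invC_norm w1 expr1n invr1 mul1r.
rewrite (_ : _.[x] = \sum_(m < B) \sum_(n < B)
    p m n * ((x * w) ^+ m * Num.conj (x * w) ^+ n)) ?p_ge0//.
rewrite /line_poly horner_sum; apply: eq_bigr => m _.
rewrite horner_sum; apply: eq_bigr => n _.
rewrite hornerZ hornerXn rmorphM/= (CrealP xr) wc !exprMn expfzDr// exprD.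
by rewrite -exprnP -exprnN exprVn; ring.
Qed.

Lemma coef_line_poly w k : (line_poly w)`_k =
  \sum_(m < B) \sum_(n < B) (if (m + n == k)%N then p m n * w ^ (m%:Z - n%:Z)
    else 0).
Proof.
rewrite /line_poly coef_sum; apply: eq_bigr => m _.
rewrite coef_sum; apply: eq_bigr => n _.
by rewrite coefZ coefXn eq_sym; case: eqP; rewrite ?mulr1 ?mulr0.
Qed.

Lemma line_poly_conj w : `|w| = 1 ->
  map_poly Num.conj (line_poly w) = line_poly w.
Proof.
by move=> w1; apply: conj_poly_id => x xr; apply: ger0_real;
  exact: horner_line_poly.
Qed.

(** The restrictions to lines have real coefficients, and averaging them over the nodes [w] isolates
    [p a b], since a + b and b - a determine (a, b). The exponents that arise are below 2B in
    modulus, so B + B nodes suffice. *)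
Lemma coef_hermitian (m n : 'I_B) : p n m = Num.conj (p m n).
Proof.
have B0 : (0 < B + B)%N by have := ltn_ord m; lia.
have [w [w1 wE]] := @circle_nodes C _ B0.
have coef_p (a b : 'I_B) : \sum_j w j ^ (b%:Z - a%:Z) * (line_poly (w j))`_(a + b) =
    (B + B)%:R * p a b.
  transitivity (\sum_(i < B) \sum_(k < B)
      (if (i == a) && (k == b) then (B + B)%:R * p a b else 0)); last first.
    rewrite (bigD1 a)//= (bigD1 b)//= !eqxx big1 => [|k /negbTE ->//].
    rewrite big1 ?addr0// => i /negbTE ->; exact: big1.
  under eq_bigr do rewrite coef_line_poly mulr_sumr.
  rewrite exchange_big/=; apply: eq_bigr => i _.
  under eq_bigr do rewrite mulr_sumr.
  rewrite exchange_big/=; apply: eq_bigr => k _.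
  have [e|e] := eqVneq (i + k)%N (a + b)%N; last first.
    rewrite big1 => [|j _]; last by rewrite mulr0.
    by case: eqP => //= ma; case: eqP => //= nb; rewrite ma nb eqxx in e.
  under eq_bigr => j _.
    have wj0 : w j != 0 by rewrite -normr_eq0 w1 oner_eq0.
    rewrite mulrCA -expfzDr//; over.
  have lm := ltn_ord i; have ln := ltn_ord k; have la := ltn_ord a;
    have lb := ltn_ord b.
  rewrite -mulr_sumr wE; last by lia.
  case: eqP => [e0|e0].
    have ma : i = a by apply: val_inj => /=; lia.
    have nb : k = b by apply: val_inj => /=; lia.
    by rewrite ma nb !eqxx/= mulrC.
  rewrite mulr0; case: eqP => //= ma; case: eqP => //= nb; case: e0.
  by rewrite ma nb; ring.
have BBN0 : (B + B)%:R != 0 :> C by rewrite pnatr_eq0 -lt0n.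
apply: (mulfI BBN0); rewrite -coef_p -[(B + B)%:R]conjC_nat -rmorphM/= -coef_p.
rewrite rmorph_sum/=; apply: eq_bigr => j _.
rewrite rmorphM/= -coef_map/= line_poly_conj// addnC; congr (_ * _).
have wc : Num.conj (w j) = (w j)^-1 by rewrite invC_norm w1 expr1n invr1 mul1r.
have wu : w j \is a GRing.unit by rewrite unitfE -normr_eq0 w1 oner_eq0.
by rewrite rmorphXz//= wc exprz_inv opprB.
Qed.

Lemma fejer_cone h : (0 < h)%N -> (B <= h)%N ->
  gram_cone (fun F : int * int -> C => F (0, 0) / h%:R +
    \sum_(m < B) \sum_(n < B)
      (p m n * F (m%:Z, n%:Z)) *+ (h - `|m%:Z - n%:Z|) / h%:R).
Proof.
move=> h0 Bh; have hN0 : h%:R != 0 :> C by rewrite pnatr_eq0 -lt0n.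
(* This makes the restricted polynomials strictly positive, as the factorization requires; it is the
   source of the term [F (0, 0) / h%:R]. *)
pose eps : C := h%:R^-1.
have eps0 : 0 < eps by rewrite invr_gt0 ltr0n.
(* The exponents t - e + m - n met below are less than B + h in modulus, within the range where the
   quadrature is exact. *)
pose M := (B + h)%N; have M0 : (0 < M)%N by rewrite /M; lia.
have MN0 : M%:R != 0 :> C by rewrite pnatr_eq0 -lt0n.
have [w [w1 wE]] := @circle_nodes C _ M0.
have wN0 j : w j != 0 by rewrite -normr_eq0 w1 oner_eq0.
have wc j : Num.conj (w j) = (w j)^-1 by rewrite invC_norm w1 expr1n invr1 mul1r.
have [P PE] : exists P : 'I_M -> {poly C}, forall j,
    line_poly (w j) + eps%:P = P j * map_poly Num.conj (P j).
  apply: (@fin_all_exists _ _ (fun j Pj => _ = Pj * map_poly Num.conj Pj)) => j.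
  apply: positive_poly_eq_mul_conj => x xr.
  by rewrite hornerD hornerC ltr_wpDl// horner_line_poly.
pose A := \max_j size (P j).
have PA j : (size (P j) <= A)%N by exact: leq_bigmax.
(* The coefficient of r^a e^(i e theta) in the product of P_j(r) and the sum over s < h of (e^(i
   theta) / w_j)^s. *)
pose lam j (a e : nat) := (P j)`_a * w j ^ (- e%:Z).
pose Phi j (F : int * int -> C) :=
  \sum_(a < A) \sum_(e < h) \sum_(b < A) \sum_(t < h)
    polar F (a%:Z + b%:Z) (e%:Z - t%:Z) * lam j a e * Num.conj (lam j b t).
have PhiE j F : Phi j F = \sum_(e < h) \sum_(t < h) w j ^ (t%:Z - e%:Z) *
    (\sum_(m < B) \sum_(n < B) p m n * w j ^ (m%:Z - n%:Z) *
       polar F (m%:Z + n%:Z) (e%:Z - t%:Z) + eps * polar F 0 (e%:Z - t%:Z)).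
  rewrite /Phi exchange_big/=; apply: eq_bigr => e _.
  under eq_bigr do rewrite exchange_big/=.
  rewrite exchange_big/=; apply: eq_bigr => t _.
  transitivity (w j ^ (t%:Z - e%:Z) *
      coef_lin (fun k => polar F k%:Z (e%:Z - t%:Z)) (line_poly (w j) + eps%:P)).
    rewrite PE (coef_lin_mul_conj _ (PA j)) mulr_sumr; apply: eq_bigr => a _.
    rewrite mulr_sumr; apply: eq_bigr => b _.
    rewrite /lam rmorphM/= rmorphXz ?unitfE//= wc exprz_inv opprK PoszD expfzDr//.
    by ring.
  rewrite coef_linD coef_linC; congr (_ * (_ + _)).
  rewrite /line_poly coef_lin_sum; apply: eq_bigr => m _.
  by rewrite coef_lin_sum; apply: eq_bigr => n _; rewrite coef_linZX PoszD.
have sumPhi F : \sum_j Phi j F = M%:R * h%:R * (F (0, 0) / h%:R +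
    \sum_(m < B) \sum_(n < B)
      (p m n * F (m%:Z, n%:Z)) *+ (h - `|m%:Z - n%:Z|) / h%:R).
  under eq_bigr do rewrite PhiE.
  rewrite exchange_big/=.
  transitivity (\sum_(e < h) \sum_(t < h)
    (\sum_(m < B) \sum_(n < B) (if e%:Z - t%:Z == m%:Z - n%:Z
       then M%:R * (p m n * F (m%:Z, n%:Z)) else 0) +
     (if e%:Z - t%:Z == 0 then M%:R * (eps * F (0, 0)) else 0))).
    apply: eq_bigr => e _; rewrite exchange_big/=; apply: eq_bigr => t _.
    have le := ltn_ord e; have lt := ltn_ord t.
    under eq_bigr do rewrite mulrDr.
    rewrite big_split/=; congr (_ + _).
      under eq_bigr do rewrite mulr_sumr.
      rewrite exchange_big/=; apply: eq_bigr => m _.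
      under eq_bigr do rewrite mulr_sumr.
      rewrite exchange_big/=; apply: eq_bigr => n _.
      have lm := ltn_ord m; have ln := ltn_ord n.
      transitivity (p m n * polar F (m%:Z + n%:Z) (e%:Z - t%:Z) *
          \sum_j w j ^ (t%:Z - e%:Z + (m%:Z - n%:Z))).
        rewrite mulr_sumr; apply: eq_bigr => j _;
          rewrite [X in _ = _ * X]expfzDr//; ring.
      rewrite wE; last by rewrite /M; lia.
      case: eqP => [e0|e0].
        have -> : e%:Z - t%:Z = m%:Z - n%:Z by lia.
        by rewrite polarE eqxx; ring.
      by rewrite mulr0; case: eqP => // e1; case: e0; rewrite -e1; ring.
    rewrite -mulr_suml wE; last by rewrite /M; lia.
    rewrite -[t%:Z - _]opprB oppr_eq0; case: eqP => [->|_]; last by rewrite mul0r.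
    by rewrite -(@polarE _ F 0 0)//= addr0 subr0.
  rewrite (_ : \sum_(e < h) _ = \sum_(e < h) \sum_(t < h)
      \sum_(m < B) \sum_(n < B) (if e%:Z - t%:Z == m%:Z - n%:Z
        then M%:R * (p m n * F (m%:Z, n%:Z)) else 0) +
    \sum_(e < h) \sum_(t < h)
      (if e%:Z - t%:Z == 0 then M%:R * (eps * F (0, 0)) else 0)); last first.
    by rewrite -big_split; apply: eq_bigr => e _; rewrite -big_split.
  rewrite sum_diag_shift// subn0.
  rewrite -[_ *+ h]mulr_natl addrC mulrDr; congr (_ + _).
    by rewrite /eps; ring.
  transitivity (\sum_(m < B) \sum_(n < B) (M%:R * (p m n * F (m%:Z, n%:Z)))
      *+ (h - `|m%:Z - n%:Z|)).
    under eq_bigr do rewrite exchange_big/=.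
    rewrite exchange_big/=; apply: eq_bigr => m _.
    under eq_bigr do rewrite exchange_big/=.
    rewrite exchange_big/=; apply: eq_bigr => n _.
    have lm := ltn_ord m; have ln := ltn_ord n.
    by rewrite sum_diag_shift//; lia.
  rewrite mulr_sumr; apply: eq_bigr => m _; rewrite mulr_sumr;
    apply: eq_bigr => n _.
  move: (h - _)%N (p m n * F _) => k y.
  by rewrite -(mulr_natl (M%:R * y)) -(mulr_natl y); field.
apply: gram_cone_ext (@gram_coneZ _ (M%:R * h%:R)^-1 _ _
  (@gram_cone_sum _ _ (index_enum 'I_M) Phi (fun j =>
    gram_cone_polar A h (lam j)))).
  by move=> F; rewrite sumPhi mulrA mulVf ?mul1r// mulf_neq0.
by rewrite invr_ge0 mulr_ge0.
Qed.

(** When |m - n| <= h, this is h times the amount by which the Fejer weight reduces the coefficient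
    [p m n]. *)
Definition excess (m n : nat) : C := p m n * `|m%:Z - n%:Z|%N%:R.

(** Apart from the factor 1/h, the diagonal remainder: 1 from [eps], and half of the diagonal terms
    of the B * B squares |1 + excess z^m zbar^n|^2. *)
Definition diag_coef (k : nat) : C :=
  (if k == 0%N then 1 + 2^-1 * (B * B)%:R else 0) +
  2^-1 * \sum_(m < B) \sum_(n < B)
    (if (m + n == k)%N then `|excess m n| ^+ 2 else 0).

Lemma diag_coef_ge0 k : 0 <= diag_coef k.
Proof.
have half_ge0 : 0 <= 2^-1 :> C by rewrite invr_ge0.
rewrite /diag_coef addr_ge0//; first by case: ifP; rewrite // addr_ge0 ?mulr_ge0.
rewrite mulr_ge0//; apply: sumr_ge0 => m _; apply: sumr_ge0 => n _.
by case: ifP => // _; rewrite exprn_ge0.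
Qed.

Lemma diag_sum (F : int * int -> C) :
  \sum_(k < (B + B).+1) diag_coef k * F (k%:Z, k%:Z) = F (0, 0) +
  2^-1 * \sum_(m < B) \sum_(n < B)
    (F (0, 0) + `|excess m n| ^+ 2 * F ((m + n)%:Z, (m + n)%:Z)).
Proof.
under eq_bigr do rewrite mulrDl.
rewrite big_split/= big_ord_recl big1 ?addr0 => [|k _]; last by rewrite /= mul0r.
rewrite eqxx; have -> : \sum_(m < B) \sum_(n < B)
      (F (0, 0) + `|excess m n| ^+ 2 * F ((m + n)%:Z, (m + n)%:Z)) =
    (B * B)%:R * F (0, 0) +
      \sum_(m < B) \sum_(n < B) `|excess m n| ^+ 2 * F ((m + n)%:Z, (m + n)%:Z).
  under eq_bigr do rewrite big_split/=.
  rewrite big_split/=; congr (_ + _).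
  under eq_bigr do rewrite sumr_const card_ord.
  by rewrite sumr_const card_ord -mulrnA mulr_natl.
rewrite mulrDl mul1r mulrDr mulrA -addrA; congr (_ + (_ + _)).
under eq_bigr do rewrite -mulrA mulr_suml.
rewrite -mulr_sumr exchange_big/=; congr (_ * _); apply: eq_bigr => m _.
under eq_bigr do rewrite mulr_suml.
rewrite exchange_big/=; apply: eq_bigr => n _.
have lm := ltn_ord m; have ln := ltn_ord n.
have lt : (m + n < (B + B).+1)%N by lia.
rewrite (bigD1 (Ordinal lt))//= eqxx big1 ?addr0// => k ne.
case: eqP => [e|_]; last by rewrite mul0r.
by case/eqP: ne; apply: val_inj.
Qed.

(** The cross terms of the added squares cancel the Fejer error exactly. The remainder coefficients
    do not depend on [h], so the perturbation tends to 0 as [h] grows. *)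
Theorem gram_certificate h : (0 < h)%N -> (B <= h)%N ->
  gram_cone (fun F : int * int -> C =>
    \sum_(m < B) \sum_(n < B) p m n * F (m%:Z, n%:Z) +
    h%:R^-1 * \sum_(k < (B + B).+1) diag_coef k * F (k%:Z, k%:Z)).
Proof.
move=> h0 Bh; have hN0 : h%:R != 0 :> C by rewrite pnatr_eq0 -lt0n.
pose s (m n : nat) : seq ((int * int) * C) :=
  [:: ((0, 0), 1); ((m%:Z, n%:Z), excess m n)].
have s_cone m n : gram_cone (fun F => gram F (s m n)).
  by apply: gram_cone_gram => x; rewrite !inE => /orP[] /eqP ->.
have c2h : 0 <= (2 * h%:R)^-1 :> C by rewrite invr_ge0 mulr_ge0.
apply: gram_cone_ext (gram_coneD (fejer_cone h0 Bh) (gram_coneZ c2h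
  (@gram_cone_sum _ _ (index_enum 'I_B) _ (fun m =>
     @gram_cone_sum _ _ (index_enum 'I_B) _ (fun n => s_cone m n))))) => F.
rewrite diag_sum.
have gramE m n : gram F (s m n) =
    (F (0, 0) + `|excess m n| ^+ 2 * F ((m + n)%:Z, (m + n)%:Z)) +
    (excess m n * F (m%:Z, n%:Z) + Num.conj (excess m n) * F (n%:Z, m%:Z)).
  rewrite /gram /s !big_cons !big_nil /= !add0r !addr0 conjC1 !PoszD.
  by rewrite [n%:Z + m%:Z]addrC normCK; ring.
under [X in _ + _ * X = _]eq_bigr do under eq_bigr do rewrite gramE.
under [X in _ + _ * X = _]eq_bigr do rewrite big_split/=.
rewrite [X in _ + _ * X = _]big_split/=.
(* By hermitian symmetry of the coefficients, exchanging m and n turns the conjugate half of the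
   cross terms into the other half. *)
have -> : \sum_(m < B) \sum_(n < B) (excess m n * F (m%:Z, n%:Z) +
      Num.conj (excess m n) * F (n%:Z, m%:Z)) =
    2 * \sum_(m < B) \sum_(n < B) excess m n * F (m%:Z, n%:Z).
  under eq_bigr do rewrite big_split/=.
  rewrite big_split/= mulr2n mulrDl mul1r; congr (_ + _).
  rewrite exchange_big/=; apply: eq_bigr => m _; apply: eq_bigr => n _.
  rewrite /excess rmorphM/= conjC_nat -coef_hermitian; congr (_ * _%:R * _).
  by rewrite -abszN opprB.
set S := \sum_(m < B) \sum_(n < B) (_ + _ * _).
have -> : \sum_(m < B) \sum_(n < B) p m n * F (m%:Z, n%:Z) =
    \sum_(m < B) \sum_(n < B)
      (p m n * F (m%:Z, n%:Z)) *+ (h - `|m%:Z - n%:Z|) / h%:R +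
    h%:R^-1 * \sum_(m < B) \sum_(n < B) excess m n * F (m%:Z, n%:Z).
  rewrite mulr_sumr -big_split/=; apply: eq_bigr => m _.
  rewrite mulr_sumr -big_split/=; apply: eq_bigr => n _.
  have lm := ltn_ord m; have ln := ltn_ord n.
  rewrite /excess; move: (F _) => y; rewrite -(mulr_natl (p m n * y)).
  by rewrite natrB; [field|lia].
by field.
Qed.

End Certificate.

(** * Finite systems and formal sums *)

Lemma fsbig_list (V : nmodType) (I : choiceType) (A : set I) (r : seq I)
    (f : I -> V) : uniq r -> (forall i, i \in r -> A i) ->
    (forall i, A i -> f i != 0 -> i \in r) ->
  \sum_(i \in A) f i = \sum_(i <- r) f i.
Proof.
move=> ur rA fr; rewrite (fsbigE r)//; last first.
  by move=> i Ai; apply: contraNeq; exact: fr.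
rewrite big_seq_cond [RHS]big_seq; apply: eq_bigl => i.
by case ir: (i \in r) => //=; apply/mem_set/rA.
Qed.

Lemma finite_system_list (V : nmodType) (I : choiceType) (A : set I) (a : I -> V) :
  finite_system A a -> exists r : seq I, [/\ uniq r, (forall i, i \in r -> A i) &
    forall i, A i -> a i != 0 -> i \in r].
Proof.
move=> /finite_seqP[r rE]; exists (undup r); split; first exact: undup_uniq.
  move=> i; rewrite mem_undup => ir.
  by have : [set` r] i by []; rewrite -rE => -[].
move=> i Ai ai; rewrite mem_undup.
by have : [set i | A i /\ a i != 0] i by []; rewrite rE.
Qed.

Lemma finite_system_sub (V : nmodType) (I : choiceType) (A : set I) (r : seq I)
    (a : I -> V) : (forall i, A i -> a i != 0 -> i \in r) -> finite_system A a.
Proof.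
move=> h; apply: (@sub_finite_set _ _ [set` r]); last by apply/finite_seqP;
  exists r.
by move=> i [Ai ai]; exact: h.
Qed.

Lemma finite_system_bound (V : nmodType) (T : set (nat * nat)) (p : nat * nat
  -> V) :
  finite_system T p -> exists B, forall m n, T (m, n) -> p (m, n) != 0 ->
    (m < B)%N && (n < B)%N.
Proof.
move=> /finite_system_list[r [_ _ pr]].
exists (\max_(k <- r) maxn k.1 k.2).+1 => m n Tmn pmn.
have := @leq_bigmax_seq _ r xpredT (fun k : nat * nat => maxn k.1 k.2) (m, n)
  (pr _ Tmn pmn) isT.
by rewrite geq_max !ltnS.
Qed.

Lemma finite_system_square (V : nmodType) (T : set (nat * nat)) N
    (p : nat * nat -> V) :
  (forall m n, T (m, n) -> p (m, n) != 0 -> (m < N)%N && (n < N)%N) ->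
  finite_system T p.
Proof.
move=> h; apply: (@finite_system_sub _ _ _ [seq (m, n) | m <- iota 0 N, n <-
  iota 0 N]).
move=> [m n] Tmn /(h _ _ Tmn)/andP[mN nN].
by apply/allpairsP; exists (m, n); rewrite !mem_iota.
Qed.

Lemma fsbig_square (V : nmodType) (T : set (nat * nat)) N (f : nat * nat -> V) :
  (forall m n, T (m, n) -> f (m, n) != 0 -> (m < N)%N && (n < N)%N) ->
  \sum_(k \in T) f k =
  \sum_(m < N) \sum_(n < N) (if (m : nat, n : nat) \in T then f (m : nat, n :
    nat) else 0).
Proof.
move=> h; pose r := [seq (m, n) | m <- index_iota 0 N, n <- index_iota 0 N].
rewrite (@fsbig_list _ _ _ [seq k <- r | k \in T]).
- rewrite big_filter big_mkcond big_allpairs_dep/= big_mkord.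
  by apply: eq_bigr => m _; rewrite big_mkord.
- apply: filter_uniq; apply: allpairs_uniq; rewrite ?iota_uniq//.
  by move=> [? ?] [? ?].
- by move=> i; rewrite mem_filter => /andP[/set_mem].
move=> [m n] Tmn /(h _ _ Tmn)/andP[mN nN].
rewrite mem_filter mem_set//=; apply/allpairsP; exists (m, n).
by rewrite !mem_index_iota.
Qed.

(** Exponents may repeat in a formal sum; their coefficients are collected here. *)
Definition coef_of (V : nmodType) (I : eqType) (s : seq (I * V)) (i : I) : V :=
  \sum_(x <- s | x.1 == i) x.2.

Lemma coef_of_finite (V : nmodType) (I : choiceType) (A : set I) (s : seq (I * V)) :
  finite_system A (coef_of s).
Proof.
apply: (@finite_system_sub _ _ _ (map fst s)) => i _; apply: contraNT => ni.
rewrite /coef_of big1_seq// => x /andP[/eqP xi xs].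
by case/negP: ni; apply/mapP; exists x.
Qed.

Lemma sum_coef_of (V : nzRingType) (I : choiceType) (s : seq (I * V)) (r : seq I)
    (G : I -> V) : uniq r -> (forall x, x \in s -> x.1 \in r) ->
  \sum_(i <- r) G i * coef_of s i = \sum_(x <- s) G x.1 * x.2.
Proof.
move=> ur sr; under eq_bigr do rewrite /coef_of big_mkcond mulr_sumr.
rewrite exchange_big/= [LHS]big_seq [RHS]big_seq; apply: eq_bigr => x xs.
rewrite (bigD1_seq x.1) ?sr//= eqxx big1 ?addr0// => i.
by rewrite eq_sym => /negbTE ->; rewrite mulr0.
Qed.

(** * Formal sums as systems and as functions away from 0 *)

Section FormalSums.
Variable R : realType.
Local Notation C := R[i].
Implicit Types (s : seq ((int * int) * C)) (z : C).

Lemma gram_coef_of (F : int * int -> C) s :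
  (forall x, x \in s -> Nplus x.1) ->
  \sum_(u \in Nplus `*` Nplus) F (u.1.1 + u.2.2, u.1.2 + u.2.1) *
     coef_of s u.1 * Num.conj (coef_of s u.2) = gram F s.
Proof.
move=> sN; pose r := undup (map fst s).
have sr x : x \in s -> x.1 \in r.
  by move=> xs; rewrite mem_undup; apply/mapP; exists x.
have rN i : i \in r -> Nplus i.
  by rewrite mem_undup => /mapP[x xs ->]; exact: sN.
have rs i : coef_of s i != 0 -> i \in r.
  apply: contraNT => ir; rewrite /coef_of big1_seq// => x /andP[/eqP xi xs].
  by rewrite -xi sr in ir.
rewrite (@fsbig_list _ _ _ [seq (u, v) | u <- r, v <- r]); last 3 first.
- by apply: allpairs_uniq; rewrite ?undup_uniq// => -[? ?] [? ?].
- by move=> [u v] /allpairsP[[a b]/= [ar br [-> ->]]]; split; exact: rN.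
- move=> [u v]/= _ uv; apply/allpairsP; exists (u, v); split=> //; apply: rs.
    by apply: contraNneq uv => ->; rewrite mulr0 mul0r.
  by apply: contraNneq uv => ->; rewrite conjC0 mulr0.
rewrite big_allpairs_dep/=.
under eq_bigr => u _.
  under eq_bigr do rewrite mulrAC.
  rewrite -mulr_suml; over.
rewrite (sum_coef_of (fun u => \sum_(v <- r) F (u.1 + v.2, u.2 + v.1) *
  Num.conj (coef_of s v)) (undup_uniq _) sr).
rewrite /gram; apply: eq_bigr => x _.
under eq_bigr => v _ do rewrite -[F _]conjCK -rmorphM/=.
rewrite -rmorph_sum/= (sum_coef_of (fun v => Num.conj (F (x.1.1 + v.2, x.1.2 +
  v.1)))
  (undup_uniq _) sr).
rewrite rmorph_sum/= mulr_suml; apply: eq_bigr => y _.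
by rewrite rmorphM/= conjCK mulrAC.
Qed.

Definition laurent_sum s z : C := \sum_(x <- s) x.2 * laurent_monom x.1 z.

Lemma laurent_sum_CNplus s : (forall x, x \in s -> Nplus x.1) ->
  in_CNplus (laurent_sum s).
Proof.
move=> sN; exists (coef_of s); split; first exact: coef_of_finite.
move=> z z0; pose r := undup (map fst s).
have sr x : x \in s -> x.1 \in r.
  by move=> xs; rewrite mem_undup; apply/mapP; exists x.
rewrite (@fsbig_list _ _ _ r) ?undup_uniq//; last 2 first.
- by move=> i; rewrite mem_undup => /mapP[x xs ->]; exact: sN.
- move=> i _; apply: contraNT => ir; rewrite /coef_of big1_seq ?mul0r//.
  by move=> x /andP[/eqP xi xs]; rewrite -xi sr in ir.
under [RHS]eq_bigr do rewrite mulrC.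
rewrite (sum_coef_of (fun k => laurent_monom k z) (undup_uniq _) sr).
by apply: eq_bigr => x _; rewrite mulrC.
Qed.

Lemma conj_exprz z (k : int) : Num.conj (z ^ k) = Num.conj z ^ k.
Proof.
case: k => n; first by rewrite -!exprnP rmorphXn.
by rewrite NegzE -!exprnN fmorphV rmorphXn.
Qed.

Lemma conj_laurent_monom k z :
  Num.conj (laurent_monom k z) = laurent_monom (k.2, k.1) z.
Proof.
transitivity (Num.conj (z ^ k.1) * Num.conj (Num.conj z ^ k.2)).
  exact: rmorphM.
rewrite mulrC; congr (_ * _); last exact: conj_exprz.
by apply: etrans (conj_exprz _ _) _; rewrite conjCK.
Qed.

Lemma laurent_monom_mul (u v : int * int) z : z != 0 ->
  laurent_monom (u.1 + v.2, u.2 + v.1) z =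
  laurent_monom u z * Num.conj (laurent_monom v z).
Proof.
move=> z0; have cz0 : Num.conj z != 0 by rewrite fmorph_eq0.
by rewrite conj_laurent_monom /laurent_monom/= (expfzDr _ _ z0) (expfzDr _ _
  cz0) mulrACA.
Qed.

Lemma gram_laurent s z : z != 0 ->
  gram (fun k => laurent_monom k z) s = `|laurent_sum s z| ^+ 2.
Proof.
move=> z0; rewrite normCK /laurent_sum rmorph_sum/= big_distrlr/=.
apply: eq_bigr => x _; apply: eq_bigr => y _.
rewrite (laurent_monom_mul x.1 y.1 z0).
move: (laurent_monom x.1 z) (laurent_monom y.1 z) => a b.
by rewrite rmorphM/=; ring.
Qed.

End FormalSums.

(** * Continuity and measurability of complex functions *)

Section ComplexFunctions.
Variable R : realType.
Local Notation C := R[i].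
Implicit Types (g h : C -> C) (z : C) (k : nat * nat).

Lemma normc_ge_Im z : (`|complex.Im z|%:C <= `|z|).
Proof.
rewrite -[`|complex.Im z|]normrN -ReiNIm; apply: le_trans (normc_ge_Re _) _.
by rewrite normrM [X in _ * X](_ : _ = 1) ?mulr1// normc_def/= expr0n expr1n
  add0r sqrtr1.
Qed.

(* Canonical inference does not find this instance. *)
Lemma nbhs_complex_filter (z : (R[i])^o) : Filter (nbhs z).
Proof. exact: nbhs_filter. Qed.

Lemma continuous_Re : continuous (fun z : (R[i])^o => complex.Re z : R).
Proof.
move=> z; have FF := nbhs_complex_filter z.
apply/(@cvgrPdist_lt _ _ _ _ FF) => e e0; apply/(@nbhs_ballP _ (R[i])^o).
exists e%:C; first by rewrite /= ltcR.
move=> w; rewrite -ball_normE /ball_/= => h.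
by rewrite -ltcR -raddfB; apply: le_lt_trans (normc_ge_Re _) h.
Qed.

Lemma continuous_Im : continuous (fun z : (R[i])^o => complex.Im z : R).
Proof.
move=> z; have FF := nbhs_complex_filter z.
apply/(@cvgrPdist_lt _ _ _ _ FF) => e e0; apply/(@nbhs_ballP _ (R[i])^o).
exists e%:C; first by rewrite /= ltcR.
move=> w; rewrite -ball_normE /ball_/= => h.
by rewrite -ltcR -raddfB; apply: le_lt_trans (normc_ge_Im _) h.
Qed.

Definition continuous_ReIm g : Prop :=
  continuous (fun z : (R[i])^o => complex.Re (g z) : R) /\
  continuous (fun z : (R[i])^o => complex.Im (g z) : R).

Lemma cReM (x y : C) : complex.Re (x * y) =
  complex.Re x * complex.Re y - complex.Im x * complex.Im y.
Proof. by case: x y => [? ?] [? ?]. Qed.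

Lemma cImM (x y : C) : complex.Im (x * y) =
  complex.Re x * complex.Im y + complex.Im x * complex.Re y.
Proof. by case: x y => [? ?] [? ?]. Qed.

Lemma cReD (x y : C) : complex.Re (x + y) = complex.Re x + complex.Re y.
Proof. by case: x y => [? ?] [? ?]. Qed.

Lemma cImD (x y : C) : complex.Im (x + y) = complex.Im x + complex.Im y.
Proof. by case: x y => [? ?] [? ?]. Qed.

Lemma cRe_conj (x : C) : complex.Re (Num.conj x) = complex.Re x.
Proof. by case: x. Qed.

Lemma cIm_conj (x : C) : complex.Im (Num.conj x) = - complex.Im x.
Proof. by case: x. Qed.

Lemma continuous_ReImM g h : continuous_ReIm g -> continuous_ReIm h ->
  continuous_ReIm (fun z => g z * h z).
Proof.
move=> [g1 g2] [h1 h2]; split.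
  under eq_fun do rewrite cReM; move=> z; have FF := nbhs_complex_filter z.
  by apply: cvgB; apply: cvgM; [exact: g1|exact: h1|exact: g2|exact: h2].
under eq_fun do rewrite cImM; move=> z; have FF := nbhs_complex_filter z.
by apply: cvgD; apply: cvgM; [exact: g1|exact: h2|exact: g2|exact: h1].
Qed.

Lemma continuous_ReImD g h : continuous_ReIm g -> continuous_ReIm h ->
  continuous_ReIm (fun z => g z + h z).
Proof.
move=> [g1 g2] [h1 h2]; split.
  under eq_fun do rewrite cReD; move=> z; have FF := nbhs_complex_filter z.
  by apply: cvgD; [exact: g1|exact: h1].
under eq_fun do rewrite cImD; move=> z; have FF := nbhs_complex_filter z.
by apply: cvgD; [exact: g2|exact: h2].
Qed.

Lemma continuous_ReIm_cst (a : C) : continuous_ReIm (fun=> a).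
Proof.
by split => z; have FF := nbhs_complex_filter z; exact: (@cvg_cst _ _ _ _ FF).
Qed.

Lemma continuous_ReIm_id : continuous_ReIm id.
Proof. by split; [exact: continuous_Re|exact: continuous_Im]. Qed.

Lemma continuous_ReIm_conj : continuous_ReIm (fun z => Num.conj z).
Proof.
split.
  by under eq_fun do rewrite cRe_conj; exact: continuous_Re.
under eq_fun do rewrite cIm_conj; move=> z; have FF := nbhs_complex_filter z.
by apply: cvgN; exact: continuous_Im.
Qed.

Lemma continuous_ReImX g n : continuous_ReIm g -> continuous_ReIm (fun z =>
  g z ^+ n).
Proof.
move=> cg; elim: n => [|n ih].
  by under eq_fun do rewrite expr0; exact: continuous_ReIm_cst.
by under eq_fun do rewrite exprS; exact: continuous_ReImM.
Qed.

Lemma continuous_ReIm_monom k : continuous_ReIm (monom k).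
Proof.
apply: continuous_ReImM; apply: continuous_ReImX.
  exact: continuous_ReIm_id.
exact: continuous_ReIm_conj.
Qed.

Lemma continuous_ReIm_sum (I : Type) (r : seq I) (g : I -> C -> C) :
  (forall i, continuous_ReIm (g i)) -> continuous_ReIm (fun z =>
    \sum_(i <- r) g i z).
Proof.
move=> cg; elim: r => [|i r ih].
  by under eq_fun do rewrite big_nil; exact: continuous_ReIm_cst.
by under eq_fun do rewrite big_cons; exact: continuous_ReImD.
Qed.

Definition measurable_ReIm g : Prop :=
  measurable_fun [set: complexBorel R] (fun z : complexBorel R =>
    complex.Re (g z) : R) /\
  measurable_fun [set: complexBorel R] (fun z : complexBorel R =>
    complex.Im (g z) : R).

Lemma continuous_measurable_ReIm g : continuous_ReIm g -> measurable_ReIm g.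
Proof. by move=> [g1 g2]; split; exact: measurable_continuous. Qed.

Lemma measurable_ReImM g h : measurable_ReIm g -> measurable_ReIm h ->
  measurable_ReIm (fun z => g z * h z).
Proof.
move=> [g1 g2] [h1 h2]; split.
  under eq_fun do rewrite cReM.
  by apply: measurable_funB; exact: measurable_funM.
under eq_fun do rewrite cImM.
by apply: measurable_funD; exact: measurable_funM.
Qed.

Lemma measurable_ReImD g h : measurable_ReIm g -> measurable_ReIm h ->
  measurable_ReIm (fun z => g z + h z).
Proof.
move=> [g1 g2] [h1 h2]; split.
  by under eq_fun do rewrite cReD; exact: measurable_funD.
by under eq_fun do rewrite cImD; exact: measurable_funD.
Qed.

Lemma measurable_inv : measurable_fun setT (fun x : R => x^-1).
Proof.
have -> : setT = [set x : R | x != 0] `|` [set 0].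
  by apply/seteqP; split=> // x _; have [->|x0] := eqVneq x 0; [right|left].
have o : open [set x : R | x != 0].
  by apply: open_neq.
apply/measurable_funU; [exact: open_measurable|exact: measurable_set1|split].
  apply: open_continuous_measurable_fun => // x /set_mem/= x0.
  exact: inv_continuous.
exact: measurable_fun_set1.
Qed.

Lemma measurable_ReImV g : measurable_ReIm g -> measurable_ReIm (fun z => (g z)^-1).
Proof.
move=> [g1 g2].
have n : measurable_fun [set: complexBorel R]
    (fun z : complexBorel R => (complex.Re (g z) ^+ 2 + complex.Im (g z) ^+
      2)^-1 : R).
  apply: (measurableT_comp measurable_inv).
  by apply: measurable_funD; exact: measurable_funX.
split.
  rewrite (_ : (fun z : complexBorel R => _) = (fun z => complex.Re (g z) *
    (complex.Re (g z) ^+ 2 + complex.Im (g z) ^+ 2)^-1));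
      first exact: measurable_funM.
  by apply/funext => z; case: (g z).
rewrite (_ : (fun z : complexBorel R => _) = (fun z => - (complex.Im (g z) *
    (complex.Re (g z) ^+ 2 + complex.Im (g z) ^+ 2)^-1))).
  by apply: measurable_funN; exact: measurable_funM.
by apply/funext => z; case: (g z).
Qed.

Lemma measurable_ReIm_exprz g (k : int) : measurable_ReIm g ->
  measurable_ReIm (fun z => g z ^ k).
Proof.
move=> mg; have mX n : measurable_ReIm (fun z => g z ^+ n).
  elim: n => [|n ih].
    under eq_fun do rewrite expr0; apply: continuous_measurable_ReIm.
    exact: continuous_ReIm_cst.
  by under eq_fun do rewrite exprS; exact: measurable_ReImM.
case: k => n; first exact: mX.
by under eq_fun do rewrite NegzE -exprnN; exact: measurable_ReImV.
Qed.

(* The value at 0 makes [fun k => laurent0 k z] multiplicative on [Nplus] for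
   every z, as if z / zbar were 1 at the origin. *)
Definition laurent0 (k : int * int) z : C :=
  if z == 0 then (k.1 + k.2 == 0)%:R else laurent_monom k z.

Lemma measurable_laurent0 (k' : int * int) : measurable_ReIm (laurent0 k').
Proof.
have m0 : measurable_ReIm (fun z => (z == 0)%:R).
  have mN : measurable_fun [set: complexBorel R]
      (fun z : complexBorel R => complex.Re z ^+ 2 + complex.Im z ^+ 2 : R).
    by apply: measurable_funD; apply: measurable_funX; apply: measurable_continuous;
      [exact: continuous_Re|exact: continuous_Im].
  have -> : (fun z : C => (z == 0)%:R : C) =
      (fun z => (\1_((fun z : complexBorel R => complex.Re z ^+ 2 +
         complex.Im z ^+ 2 : R) @^-1` [set 0]) z)%:C).
    apply/funext => z; rewrite indicE; case: eqP => [->|z0].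
      by rewrite mem_set//= expr0n/= addr0.
    rewrite memNset// => /= /eqP; rewrite paddr_eq0 ?sqr_ge0// !sqrf_eq0.
    by move=> /andP[/eqP a /eqP b]; apply: z0; rewrite [z]complexE a b mulr0 addr0.
  split; last exact: measurable_cst.
  apply: measurable_indic.
  by rewrite -[X in measurable X]setTI; exact: mN.
have c a : measurable_ReIm (fun=> a).
  exact/continuous_measurable_ReIm/continuous_ReIm_cst.
have -> : laurent0 k' = (fun z => laurent_monom k' z * (1 + -1 * (z == 0)%:R) +
    (k'.1 + k'.2 == 0)%:R * (z == 0)%:R).
  apply/funext => z; rewrite /laurent0; case: eqP => _.
    by rewrite mulr1 subrr mulr0 add0r mulr1.
  by rewrite !mulr0 !addr0 mulr1.
apply: measurable_ReImD; apply: measurable_ReImM => //.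
  apply: measurable_ReImM; apply: measurable_ReIm_exprz;
  apply: continuous_measurable_ReIm; [exact: continuous_ReIm_id|exact:
    continuous_ReIm_conj].
by apply: measurable_ReImD => //; exact: measurable_ReImM.
Qed.

End ComplexFunctions.

(** * Moments of a measure *)

Section ComplexIntegral.
Variables (R : realType) (mu : {measure set (complexBorel R) -> \bar R}).
Local Notation C := R[i].
Implicit Types (f g : C -> C) (z : C).

Lemma cintegral0 : cintegrable mu (fun=> 0) /\ cintegral mu (fun=> 0) = 0.
Proof.
split; first by split; exact: integrable0.
by rewrite /cintegral /Rintegral/= integral0.
Qed.

Lemma cintegral_lin (a : C) f g : cintegrable mu f -> cintegrable mu g ->
  cintegrable mu (fun z => a * f z + g z) /\
  cintegral mu (fun z => a * f z + g z) = a * cintegral mu f + cintegral mu g.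
Proof.
move=> [f1 f2] [g1 g2].
have Z r (h : C -> R) : mu.-integrable setT (fun z => (h z)%:E) ->
  mu.-integrable setT (fun z => (r * h z)%:E) by exact: integrableZl.
have e1 : (fun z => complex.Re (a * f z + g z)) =
    (fun z => complex.Re a * complex.Re (f z) +
      (- complex.Im a * complex.Im (f z) + complex.Re (g z))).
  by apply/funext => z; rewrite cReD cReM mulNr addrA.
have e2 : (fun z => complex.Im (a * f z + g z)) =
    (fun z => complex.Re a * complex.Im (f z) +
      (complex.Im a * complex.Re (f z) + complex.Im (g z))).
  by apply/funext => z; rewrite cImD cImM addrA.
have D (h k : C -> R) : mu.-integrable setT (fun z => (h z)%:E) ->
  mu.-integrable setT (fun z => (k z)%:E) ->
  mu.-integrable setT (fun z => (h z + k z)%:E) by exact: integrableD.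
split.
  split; [have /(congr1 (fun h z => (h z)%:E)) /= -> := e1
         |have /(congr1 (fun h z => (h z)%:E)) /= -> := e2];
  by apply: (D); [exact: Z|apply: (D) => //; exact: Z].
rewrite /cintegral e1 e2 !RintegralD ?RintegralZl//;
  try by [exact: Z|apply: (D) => //; exact: Z].
by apply/eqP; rewrite eq_complex cReD cImD cReM cImM /=; apply/andP; split;
  apply/eqP; ring.
Qed.

Lemma cintegral_sum (I : eqType) (r : seq I) (a : I -> C) (f : I -> C -> C) :
  (forall i, i \in r -> cintegrable mu (f i)) ->
  cintegrable mu (fun z => \sum_(i <- r) a i * f i z) /\
  cintegral mu (fun z => \sum_(i <- r) a i * f i z) =
    \sum_(i <- r) a i * cintegral mu (f i).
Proof.
elim: r => [|i r ih] fr.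
  by under eq_fun do rewrite big_nil; rewrite big_nil; exact: cintegral0.
have [j ir|ir1 ir2] := ih; first by apply: fr; rewrite inE ir orbT.
have [|l1 l2] := cintegral_lin (a i) (fr i _) ir1; first exact: mem_head.
under eq_fun do rewrite big_cons.
by rewrite big_cons -ir2.
Qed.

Lemma cintegral_ge0 g : (forall z, 0 <= g z) -> 0 <= cintegral mu g.
Proof.
move=> g0; rewrite /cintegral lecE/=; apply/andP; split.
  rewrite (_ : (fun z => _) = (fun=> 0)) ?Rintegral_cst ?mul0r//.
  by apply/funext => z; exact: ger0_Im.
by apply: Rintegral_ge0 => z _; move: (g0 z); rewrite lecE => /andP[].
Qed.

Lemma cintegrable_le g (h : C -> R) : measurable_ReIm g ->
  mu.-integrable [set: complexBorel R] (fun z => (h z)%:E) ->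
  (forall z, `|g z| <= (h z)%:C) -> cintegrable mu g.
Proof.
move=> [m1 m2] ih gh; split; apply: (le_integrable measurableT _ _ ih).
- exact/measurable_EFinP.
- move=> z _ /=; rewrite lee_fin; apply: le_trans (ler_norm _).
  by rewrite -lecR; apply: le_trans (normc_ge_Re _) (gh z).
- exact/measurable_EFinP.
- move=> z _ /=; rewrite lee_fin; apply: le_trans (ler_norm _).
  by rewrite -lecR; apply: le_trans (normc_ge_Im _) (gh z).
Qed.

End ComplexIntegral.

Section Moments.
Variable R : realType.
Local Notation C := R[i].
Implicit Types (z : C) (k : nat * nat).

Lemma norm_monom k z : `|monom k z| = `|z| ^+ (k.1 + k.2).
Proof. by rewrite /monom normrM !normrX norm_conjC exprD. Qed.

Lemma monom_diag n z : monom (n, n) z = `|z| ^+ (n + n).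
Proof. by rewrite /monom/= -exprMn -normCK -exprM mul2n addnn. Qed.

Lemma exp_le_sqr (x : C) d D : 0 <= x -> (d <= D)%N -> x ^+ d <= 1 + x ^+ D.
Proof.
move=> x0 dD; have xr : x \is Num.real by exact: ger0_real.
have [x1|x1] := real_leP xr (@real1 C).
  by apply: (@le_trans _ _ 1); rewrite ?exprn_ile1// lerDl exprn_ge0.
apply: (@le_trans _ _ (x ^+ D)); last by rewrite lerDr.
by rewrite ler_weXn2l// ltW.
Qed.

(** Away from 0 the modulus is |z|^d with d = u.1 + u.2 >= 0, and |z|^d <= 1 + |z|^(2d). The bound
    uses diagonal monomials only, so every exponent in [Nplus] becomes integrable once the diagonal
    lies in [T]. *)
Lemma norm_laurent0_le u z : Nplus u ->
  `|laurent0 u z| <= 1 + monom (`|(u.1 + u.2)%R|%N, `|(u.1 + u.2)%R|%N) z.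
Proof.
move=> u0; have u0' : 0 <= u.1 + u.2 by [].
rewrite monom_diag /laurent0; case: eqP => [_|/eqP z0].
  by apply: (@le_trans _ _ 1); rewrite ?lerDl ?exprn_ge0// normr_nat lern1 leq_b1.
rewrite (_ : `|laurent_monom u z| = `|z| ^+ `|(u.1 + u.2)%R|%N).
  by apply: exp_le_sqr => //; rewrite leq_addr.
have nX (x : C) (j : int) : `|x ^ j| = `|x| ^ j.
  by case: j => n; rewrite ?NegzE -?exprnP -?exprnN ?normfV normrX.
have zn0 : `|z| != 0 by rewrite normr_eq0.
rewrite /laurent_monom; move: (Num.conj z) (norm_conjC z) => y yz.
by rewrite normrM !nX yz -(expfzDr _ _ zn0) exprnP gez0_abs.
Qed.

Lemma laurent0_mul u v z : Nplus u -> Nplus v ->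
  laurent0 (u.1 + v.2, u.2 + v.1) z = laurent0 u z * Num.conj (laurent0 v z).
Proof.
move=> u0 v0; rewrite /laurent0; case: eqP => [_|/eqP z0];
  last exact: laurent_monom_mul.
have u0' : 0 <= u.1 + u.2 by []. have v0' : 0 <= v.1 + v.2 by [].
(* At the origin: two nonnegative degrees add up to 0 exactly when both are 0. *)
rewrite conjC_nat -natrM mulnb /=; congr (nat_of_bool _)%:R.
by apply/eqP/andP => [?|[/eqP ? /eqP ?]]; [split; apply/eqP|]; lia.
Qed.

Lemma laurent0_monom m n z : laurent0 (m%:Z, n%:Z) z = monom (m, n) z.
Proof.
rewrite /laurent0; case: eqP => [->|//].
by rewrite /monom/= conjC0 !expr0n -natrM mulnb -PoszD eqz_nat addn_eq0.
Qed.

Lemma cintegrable_laurent0 (T : set (nat * nat)) c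
    (mu : {measure set (complexBorel R) -> \bar R}) u :
  (forall n, T (n, n)) -> represents_on T c mu -> Nplus u ->
  cintegrable mu (laurent0 u).
Proof.
move=> diagT muc u0; pose n := `|(u.1 + u.2)%R|%N.
have [[i0 _] _] := muc _ (diagT 0%N); have [[i1 _] _] := muc _ (diagT n).
apply: (@cintegrable_le _ _ _ (fun z => complex.Re (monom (0%N, 0%N) z) +
    complex.Re (monom (n, n) z))).
- exact: measurable_laurent0.
- under eq_fun do rewrite EFinD; exact: integrableD.
move=> z; apply: le_trans (norm_laurent0_le z u0) _.
rewrite -/n -cReD [monom (0, 0)%N z]monom_diag addn0 expr0.
by rewrite RRe_real// ger0_real// addr_ge0// monom_diag exprn_ge0.
Qed.

Lemma complex_moment_extension (T : set (nat * nat)) c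
    (mu : {measure set (complexBorel R) -> \bar R}) :
  (forall n, T (n, n)) -> represents_on T c mu ->
  represents_on [set: nat * nat] (fun k => cintegral mu (monom k)) mu.
Proof.
move=> diagT muc [m n] _; split=> //.
have -> : monom (m, n) = laurent0 (m%:Z, n%:Z) :> (C -> C).
  by apply/funext => z; rewrite laurent0_monom.
exact: (cintegrable_laurent0 diagT muc).
Qed.

(** Multiplicativity of [laurent0] makes the form the integral of the squared modulus of the sum of
    [lam u * laurent0 u]. *)
Lemma complex_moment_gram_ge0 (c : nat * nat -> C) : complex_moment_sequence c ->
  exists ct : int * int -> C,
    (forall m n : nat, ct (m%:Z, n%:Z) = c (m, n)) /\
    forall lam : int * int -> C, finite_system Nplus lam ->
      0 <= \sum_(u \in Nplus `*` Nplus)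
             ct (u.1.1 + u.2.2, u.1.2 + u.2.1) * lam u.1 * Num.conj (lam u.2).
Proof.
move=> [mu muc]; exists (fun u => cintegral mu (laurent0 u)); split=> [m n|lam].
  have [_ ->] := muc (m, n) Logic.I; congr cintegral.
  by apply/funext => z; rewrite laurent0_monom.
move=> /finite_system_list[r [ur rN lr]].
pose rr := [seq (u, v) | u <- r, v <- r].
have rrP w : w \in rr -> Nplus w.1 /\ Nplus w.2.
  by move=> /allpairsP[[u v]/= [ur' vr' ->]]; split; exact: rN.
rewrite (@fsbig_list _ _ _ rr); last 3 first.
- by apply: allpairs_uniq => // -[? ?] [? ?].
- by move=> w /rrP.
- move=> [u v]/= [uN vN] uv; apply/allpairsP; exists (u, v); split=> //;
    apply: lr => //.
    by apply: contraNneq uv => ->; rewrite mulr0 mul0r.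
  by apply: contraNneq uv => ->; rewrite conjC0 mulr0.
have int_rr w : w \in rr ->
    cintegrable mu (laurent0 (w.1.1 + w.2.2, w.1.2 + w.2.1)).
  move=> /rrP[w1 w2]; apply: (cintegrable_laurent0 _ muc) => //.
  by move: w1 w2; rewrite /Nplus/=; lia.
have [_] := cintegral_sum (fun w => lam w.1 * Num.conj (lam w.2)) int_rr.
under [X in _ = X -> _]eq_bigr do rewrite mulrC mulrA.
move=> <-; apply: cintegral_ge0 => z.
rewrite (_ : \sum_(w <- rr) _ = `|\sum_(u <- r) lam u * laurent0 u z| ^+ 2).
  by rewrite exprn_ge0.
rewrite normCK rmorph_sum/= big_distrlr/= big_allpairs_dep/= [LHS]big_seq
  [RHS]big_seq.
apply: eq_bigr => u /rN uN; rewrite [LHS]big_seq [RHS]big_seq.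
apply: eq_bigr => v /rN vN; rewrite /= laurent0_mul//.
move: (laurent0 u z) (laurent0 v z) => a b.
by rewrite rmorphM/=; ring.
Qed.

End Moments.

(** * Positivity of the moment functional *)

Section SystemSums.
Variables (R : realType) (T : set (nat * nat)).
Local Notation C := R[i].
Implicit Types (p q G : nat * nat -> C).

Definition pairing p G : C := \sum_(k \in T) p k * G k.

Lemma finite_system_lin (a : C) p q : finite_system T p -> finite_system T q ->
  finite_system T (fun k => a * p k + q k).
Proof.
move=> /finite_system_list[r [_ _ pr]] /finite_system_list[s [_ _ qs]].
apply: (@finite_system_sub _ _ _ (r ++ s)) => k Tk; rewrite mem_cat.
apply: contraNT => /norP[kr ks].
have -> : p k = 0 by apply/eqP; apply: contraNT kr; exact: pr.
have -> : q k = 0 by apply/eqP; apply: contraNT ks; exact: qs.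
by rewrite mulr0 addr0.
Qed.

Lemma pairing_lin (a : C) p q G : finite_system T p -> finite_system T q ->
  pairing (fun k => a * p k + q k) G = a * pairing p G + pairing q G.
Proof.
move=> /finite_system_list[r [_ rT pr]] /finite_system_list[s [_ sT qs]].
have pE f : (forall k, T k -> f k != 0 -> k \in r ++ s) ->
    pairing f G = \sum_(k <- undup (r ++ s)) f k * G k.
  move=> fr; apply: fsbig_list; first exact: undup_uniq.
    by move=> k; rewrite mem_undup mem_cat => /orP[/rT|/sT].
  move=> k Tk fk; rewrite mem_undup; apply: fr => //.
  by apply: contraNneq fk => ->; rewrite mul0r.
have pr' k : T k -> p k != 0 -> k \in r ++ s.
  by move=> Tk pk; rewrite mem_cat pr.
have qs' k : T k -> q k != 0 -> k \in r ++ s.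
  by move=> Tk qk; rewrite mem_cat qs// orbT.
rewrite !pE//; last first.
  move=> k Tk; apply: contraNT => kn.
  have -> : p k = 0 by apply/eqP; apply: contraNT kn; exact: pr'.
  have -> : q k = 0 by apply/eqP; apply: contraNT kn; exact: qs'.
  by rewrite mulr0 addr0.
by rewrite mulr_sumr -big_split; apply: eq_bigr => k _ /=; rewrite mulrDl mulrA.
Qed.

Definition unit_system (k0 : nat * nat) k : C := (k == k0)%:R.

Lemma finite_unit_system k0 : finite_system T (unit_system k0).
Proof.
apply: (@finite_system_sub _ _ _ [:: k0]) => k _; rewrite inE.
by apply: contraNT => /negbTE kk; rewrite /unit_system kk.
Qed.

Lemma pairing_unit k0 G : T k0 -> pairing (unit_system k0) G = G k0.
Proof.
move=> Tk0; rewrite /pairing (@fsbig_list _ _ _ [:: k0])//.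
- by rewrite big_seq1 /unit_system eqxx mul1r.
- by move=> k; rewrite inE => /eqP ->.
move=> k _; rewrite inE; apply: contraNT => /negbTE kk.
by rewrite /unit_system kk mul0r.
Qed.

Definition diag_system N (g : nat -> C) (k : nat * nat) : C :=
  if (k.1 == k.2) && (k.1 < N)%N then g k.1 else 0.

Lemma finite_diag_system N g : finite_system T (diag_system N g).
Proof.
apply: (@finite_system_square _ _ N) => m n _; rewrite /diag_system/=.
case: ifP => [/andP[/eqP <- ->]//|]; by rewrite eqxx.
Qed.

Lemma pairing_diag N g G : (forall n, T (n, n)) ->
  pairing (diag_system N g) G = \sum_(k < N) g k * G (k : nat, k : nat).
Proof.
move=> diagT; rewrite /pairing (@fsbig_list _ _ _ [seq (k, k) | k <- iota 0 N]).
- rewrite big_map -{1}[N]subn0 -/(index_iota 0 N) big_mkord; apply: eq_bigr => k _.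
  by rewrite /diag_system/= eqxx ltn_ord.
- by rewrite map_inj_uniq ?iota_uniq// => ? ? [].
- by move=> k /mapP[n _ ->].
move=> [m n] _; rewrite /diag_system/=; apply: contraNT => mn.
case: ifP => [/andP[/eqP e mN]|]; last by rewrite mul0r.
by case/negP: mn; apply/mapP; exists m; rewrite ?mem_iota// e.
Qed.

Lemma pairing_gram_cone p : (forall n, T (n, n)) -> finite_system T p ->
  (forall z : C, 0 <= pairing p (fun k => monom k z)) ->
  exists (B N : nat) (g : nat -> C), (forall k, 0 <= g k) /\
    forall h, (0 < h)%N -> (B <= h)%N -> gram_cone (fun F : int * int -> C =>
      pairing p (fun k => F (k.1%:Z, k.2%:Z)) +
      h%:R^-1 * \sum_(k < N) g k * F (k%:Z, k%:Z)).
Proof.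
move=> diagT /finite_system_bound[B pB] p0.
(* Values of [p] outside [T] carry no meaning and are replaced by 0 to obtain an honest
   polynomial. *)
pose pn (m n : nat) : C := if (m, n) \in T then p (m, n) else 0.
have pE G : pairing p G = \sum_(m < B) \sum_(n < B) pn m n * G (m : nat, n : nat).
  rewrite /pairing (@fsbig_square _ _ B); last first.
    move=> m n Tmn pG; apply: pB => //.
    by apply: contraNneq pG => ->; rewrite mul0r.
  apply: eq_bigr => m _; apply: eq_bigr => n _; rewrite /pn.
  by case: ifP => // _; rewrite mul0r.
have pn0 z : 0 <= \sum_(m < B) \sum_(n < B) pn m n * (z ^+ m * Num.conj z ^+ n).
  by have := p0 z; rewrite pE.
exists B, (B + B).+1, (diag_coef B pn); split; first exact: diag_coef_ge0.
move=> h h0 Bh; apply: gram_cone_ext (gram_certificate pn0 h0 Bh) => F.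
by rewrite pE.
Qed.

End SystemSums.

Section Limits.
Variable R : realType.
Local Notation C := R[i].

(** In [R[i]] being nonnegative includes being real, so the Archimedean argument [small] is applied
    to |Im x| and to - Re x. *)
Lemma small_perturbation_ge0 (x : C) (y : nat -> C) (K : R) (B : nat) :
  (forall h, `|y h| <= K%:C) ->
  (forall h, (0 < h)%N -> (B <= h)%N -> 0 <= x + h%:R^-1 * y h) -> 0 <= x.
Proof.
move=> yK xy.
have small (t : R) : (forall h, (0 < h)%N -> (B <= h)%N -> t <= h%:R^-1 * K) ->
  t <= 0.
  move=> tK; rewrite leNgt; apply/negP => t0.
  pose h := (maxn B (Num.truncn (K / t)).+1)%N.
  have h0 : (0 < h)%N by rewrite leq_max orbT.
  have := tK h h0 (leq_maxl _ _); rewrite mulrC ler_pdivlMr ?ltr0n// leNgt =>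
    /negP; apply.
  rewrite mulrC -ltr_pdivrMr//; apply: lt_le_trans (truncnS_gt _) _.
  by rewrite ler_nat leq_maxr.
have bnd h : (0 < h)%N -> `|complex.Re (h%:R^-1 * y h)| <= h%:R^-1 * K /\
    `|complex.Im (h%:R^-1 * y h)| <= h%:R^-1 * K.
  move=> h0; have hc : h%:R^-1 = (h%:R^-1 : R)%:C.
    by rewrite fmorphV rmorph_nat.
  have p : 0 <= h%:R^-1 :> R by rewrite invr_ge0.
  rewrite hc; case: (y h) (yK h) => a b yh /=; rewrite !mul0r subr0 addr0 !normrM.
  rewrite (ger0_norm p); split; apply: ler_wpM2l => //; rewrite -lecR;
    apply: le_trans yh; [exact: (normc_ge_Re (a +i* b))|].
  rewrite normc_def/= lecR -sqrtr_sqr ler_wsqrtr// lerDr sqr_ge0 //.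
have xy' h : (0 < h)%N -> (B <= h)%N -> complex.Im x = - complex.Im (h%:R^-1 *
  y h) /\
    0 <= complex.Re x + complex.Re (h%:R^-1 * y h).
  move=> h0 Bh; have := xy h h0 Bh; rewrite lecE cReD cImD /= => /andP[/eqP e1 e2].
  by split=> //; lra.
rewrite lecE/=; apply/andP; split.
  rewrite -normr_le0; apply: small => h h0 Bh.
  have [-> _] := xy' h h0 Bh; rewrite normrN; exact: (proj2 (bnd h h0)).
rewrite -oppr_le0; apply: small => h h0 Bh.
have [_ r] := xy' h h0 Bh; have [+ _] := bnd h h0.
rewrite ler_norml => /andP[_]; lra.
Qed.

End Limits.

Section Positivity.
Variables (R : realType) (T : set (nat * nat)).
Local Notation C := R[i].
Hypothesis diagT : forall n, T (n, n).
Variable c : nat * nat -> C.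

Lemma complex_norm_bound (x : C) : `|x| <= (complex.Re `|x|)%:C.
Proof. by rewrite RRe_real// ger0_real. Qed.

Lemma gram_ge0_pairing_ge0 (ct : int * int -> C) p :
  (forall m n : nat, T (m, n) -> ct (m%:Z, n%:Z) = c (m, n)) ->
  (forall lam : int * int -> C, finite_system Nplus lam ->
    0 <= \sum_(u \in Nplus `*` Nplus)
           ct (u.1.1 + u.2.2, u.1.2 + u.2.1) * lam u.1 * Num.conj (lam u.2)) ->
  finite_system T p -> (forall z, 0 <= pairing T p (fun k => monom k z)) ->
  0 <= pairing T p c.
Proof.
move=> ctc ct0 fp p0.
have [B [N [g [_ H]]]] := pairing_gram_cone diagT fp p0.
apply: (@small_perturbation_ge0 _ _ (fun=> \sum_(k < N) g k * ct (k%:Z, k%:Z)) _ B).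
  by move=> h; exact: complex_norm_bound.
move=> h h0 Bh; have [L [L1 L2]] := H h h0 Bh.
have <- : pairing T p (fun k => ct (k.1%:Z, k.2%:Z)) = pairing T p c.
  by apply: eq_fsbigr => -[m n] /set_mem Tmn /=; rewrite ctc.
rewrite L2 big_seq; apply: sumr_ge0 => s sL.
rewrite -gram_coef_of; last exact: L1.
exact/ct0/coef_of_finite.
Qed.

(** The certificate perturbs [p] by a diagonal system, so the perturbed system is still indexed by
    [T] and is a sum of squares away from 0. The hypothesis applies to it, and then [h] tends to
    infinity. *)
Lemma sos_pairing_ge0 p :
  (forall p, finite_system T p ->
    (exists (N : nat) (q : 'I_N -> C -> C),
      (forall j, in_CNplus (q j)) /\
      forall z : C, z != 0 ->
        pairing T p (fun k => monom k z) = \sum_(j < N) `|q j z| ^+ 2) ->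
    0 <= pairing T p c) ->
  finite_system T p -> (forall z, 0 <= pairing T p (fun k => monom k z)) ->
  0 <= pairing T p c.
Proof.
move=> sos fp p0.
have [B [N [g [_ H]]]] := pairing_gram_cone diagT fp p0.
apply: (@small_perturbation_ge0 _ _ (fun=> \sum_(k < N) g k * c (k : nat, k :
  nat)) _ B).
  by move=> h; exact: complex_norm_bound.
move=> h h0 Bh; have [L [L1 L2]] := H h h0 Bh.
have fd := finite_diag_system T N g.
have e G : pairing T (fun k => h%:R^-1 * diag_system N g k + p k) G =
    pairing T p G + h%:R^-1 * \sum_(k < N) g k * G (k : nat, k : nat).
  by rewrite pairing_lin// pairing_diag// addrC.
rewrite -e; apply: sos; first exact: finite_system_lin.
exists (size L), (fun j => laurent_sum (nth [::] L j)); split=> [j|z z0].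
  by apply: laurent_sum_CNplus => x; apply: L1; rewrite mem_nth.
rewrite e; have := L2 (fun k => laurent_monom k z).
rewrite (big_nth [::]) big_mkord => eL.
under [RHS]eq_bigr do rewrite -gram_laurent//.
exact: eL.
Qed.

Lemma pairing_ge0_at0 p : finite_system T p ->
  (forall z, z != 0 -> 0 <= pairing T p (fun k => monom k z)) ->
  0 <= pairing T p (fun k => monom k (0 : C)).
Proof.
move=> /finite_system_bound[B pB] p0.
pose pn (m n : nat) : C := if (m, n) \in T then p (m, n) else 0.
have pE G : pairing T p G = \sum_(m < B) \sum_(n < B) pn m n * G (m : nat, n : nat).
  rewrite /pairing (@fsbig_square _ _ B); last first.
    move=> m n Tmn pG; apply: pB => //.
    by apply: contraNneq pG => ->; rewrite mul0r.
  apply: eq_bigr => m _; apply: eq_bigr => n _; rewrite /pn.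
  by case: ifP => // _; rewrite mul0r.
(* The value at 0 is a limit along the points 1/h: for h > 0, [y h] is h times the difference of the
   values at 1/h and 0, bounded since powers of 1/h are at most 1. *)
pose y (h : nat) : C := \sum_(m < B) \sum_(n < B)
  (if (m + n == 0)%N then 0 else pn m n * h%:R^-1 ^+ (m + n).-1).
apply: (@small_perturbation_ge0 _ _ y
  (complex.Re (\sum_(m < B) \sum_(n < B) `|pn m n|)) 0).
  move=> h; rewrite RRe_real; last first.
    by apply: ger0_real; apply: sumr_ge0 => m _; apply: sumr_ge0.
  apply: le_trans (ler_norm_sum _ _ _) _; apply: ler_sum => m _.
  apply: le_trans (ler_norm_sum _ _ _) _; apply: ler_sum => n _.
  case: ifP => _; first by rewrite normr0.
  rewrite normrM ler_piMr// normrX exprn_ile1// ger0_norm ?invr_ge0//.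
  by case: h => [|h]; rewrite ?invr0// invf_le1 ?ltr0n// ler1n.
move=> h h0 _; have hN0 : h%:R^-1 != 0 :> C by rewrite invr_eq0 pnatr_eq0 -lt0n.
have hc : Num.conj (h%:R^-1 : C) = h%:R^-1 by apply/CrealP; rewrite rpredV realn.
have := p0 _ hN0; rewrite !pE mulr_sumr -big_split/=.
congr (0 <= _); apply: eq_bigr => m _; rewrite mulr_sumr -big_split/=.
apply: eq_bigr => n _; rewrite /monom/= hc conjC0 -exprD.
case: m n => [m ?] [n ?] /=.
rewrite !expr0n -natrM mulnb -addn_eq0.
case: eqP => [->|/eqP mn]; first by rewrite expr0 mulr0 addr0.
by rewrite mulr0 add0r mulrCA -exprS prednK// lt0n.
Qed.

End Positivity.

(** * Clearing denominators and determining sets *)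

Section Determining.
Variable R : realType.
Local Notation C := R[i].
Implicit Types (f g : C -> C).

(* Closed under conjugation by construction, so that |f|^2 is polynomial
   whenever f is. *)
Definition polynomial_fun f : Prop :=
  (exists P, forall z, eval_zzbar P z = f z) /\
  (exists P, forall z, eval_zzbar P z = Num.conj (f z)).

Lemma eval_zzbarD (P Q : {poly {poly C}}) z :
  eval_zzbar (P + Q) z = eval_zzbar P z + eval_zzbar Q z.
Proof. by rewrite /eval_zzbar !hornerD. Qed.

Lemma eval_zzbarM (P Q : {poly {poly C}}) z :
  eval_zzbar (P * Q) z = eval_zzbar P z * eval_zzbar Q z.
Proof. by rewrite /eval_zzbar !hornerM. Qed.

Lemma polynomial_funD f g : polynomial_fun f -> polynomial_fun g ->
  polynomial_fun (fun z => f z + g z).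
Proof.
move=> [[P1 e1] [P2 e2]] [[Q1 e3] [Q2 e4]].
split; [exists (P1 + Q1)|exists (P2 + Q2)] => z; rewrite eval_zzbarD.
  by rewrite e1 e3.
by rewrite e2 e4 rmorphD.
Qed.

Lemma polynomial_funM f g : polynomial_fun f -> polynomial_fun g ->
  polynomial_fun (fun z => f z * g z).
Proof.
move=> [[P1 e1] [P2 e2]] [[Q1 e3] [Q2 e4]].
split; [exists (P1 * Q1)|exists (P2 * Q2)] => z; rewrite eval_zzbarM.
  by rewrite e1 e3.
by rewrite e2 e4 rmorphM.
Qed.

Lemma polynomial_fun_cst (a : C) : polynomial_fun (fun=> a).
Proof.
by split; [exists a%:P%:P|exists (Num.conj a)%:P%:P] => z;
  rewrite /eval_zzbar !hornerC.
Qed.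

Lemma polynomial_fun_conj f : polynomial_fun f ->
  polynomial_fun (fun z => Num.conj (f z)).
Proof.
by move=> [fP [Q e]]; split; [exists Q|case: fP => P h; exists P => z;
  rewrite conjCK].
Qed.

Lemma polynomial_fun_id : polynomial_fun id.
Proof.
by split; [exists 'X|exists ('X)%:P] => z; rewrite /eval_zzbar ?hornerX
  ?hornerC ?hornerX.
Qed.

Lemma polynomial_funX f n : polynomial_fun f -> polynomial_fun (fun z => f z ^+ n).
Proof.
move=> pf; elim: n => [|n ih].
  by under eq_fun do rewrite expr0; exact: polynomial_fun_cst.
by under eq_fun do rewrite exprS; exact: polynomial_funM.
Qed.

Lemma polynomial_fun_sum (I : Type) (r : seq I) (f : I -> C -> C) :
  (forall i, polynomial_fun (f i)) -> polynomial_fun (fun z => \sum_(i <- r) f i z).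
Proof.
move=> pf; elim: r => [|i r ih].
  by under eq_fun do rewrite big_nil; exact: polynomial_fun_cst.
by under eq_fun do rewrite big_cons; exact: polynomial_funD.
Qed.

Lemma polynomial_fun_monom k : polynomial_fun (monom k).
Proof.
apply: polynomial_funM; apply: polynomial_funX; last apply: polynomial_fun_conj;
  exact: polynomial_fun_id.
Qed.

(** [K] is the sum of the moduli of all exponents in the support, so the shifts k.1 + K and k.2 + K
    are nonnegative. *)
Lemma CNplus_clear_denominator q : in_CNplus q -> exists (K : nat) (Q : C -> C),
  polynomial_fun Q /\ forall z, z != 0 -> Q z = (z * Num.conj z) ^+ K * q z.
Proof.
move=> [a [/finite_system_list[r [ur rN ar]] qE]].
pose K := (\sum_(k <- r) (`|k.1| + `|k.2|))%N.
have rK k : k \in r -> (`|k.1| <= K)%N && (`|k.2| <= K)%N.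
  move=> kr; have : (`|k.1| + `|k.2| <= K)%N by rewrite /K (big_rem k)//= leq_addr.
  by move=> h; apply/andP; split; lia.
exists K, (fun z => \sum_(k <- r) a k * monom (`|(k.1 + K%:Z)%R|%N, `|(k.2 +
  K%:Z)%R|%N) z).
split.
  apply: polynomial_fun_sum => k; apply: polynomial_funM;
    first exact: polynomial_fun_cst.
  exact: polynomial_fun_monom.
move=> z z0; have cz0 : Num.conj z != 0 by rewrite fmorph_eq0.
rewrite qE// (@fsbig_list _ _ _ r)//; last first.
  by move=> k kN; rewrite mulf_eq0 => /norP[ak _]; exact: ar.
rewrite mulr_sumr [LHS]big_seq [RHS]big_seq; apply: eq_bigr => k /rK /andP[k1 k2].
have e (x : C) (j : int) : x != 0 -> (`|j| <= K)%N ->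
    x ^+ `|(j + K%:Z)%R| = x ^+ K * x ^ j.
  move=> x0 jK; rewrite [LHS]exprnP gez0_abs; last by lia.
  by rewrite (expfzDr _ _ x0) mulrC.
rewrite /monom /laurent_monom /= (e _ _ z0 k1) (e _ _ cz0 k2) exprMn.
by move: (z ^ _) (_ ^ k.2) => x y; ring.
Qed.

Lemma determining_sos (Z : set C) N (q : 'I_N -> C -> C) f :
  determining Z -> polynomial_fun f -> (forall j, in_CNplus (q j)) ->
  (forall z, Z z -> z != 0 -> f z = \sum_(j < N) `|q j z| ^+ 2) ->
  forall z, z != 0 -> f z = \sum_(j < N) `|q j z| ^+ 2.
Proof.
move=> detZ pf qN eqZ.
have [K HK] := @fin_all_exists _ _ (fun j (K : nat) => exists Q : C -> C,
  polynomial_fun Q /\ forall z, z != 0 -> Q z = (z * Num.conj z) ^+ K * q j z)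
  (fun j => CNplus_clear_denominator (qN j)).
have [Q HQ] := @fin_all_exists _ _ (fun j (Q : C -> C) =>
  polynomial_fun Q /\ forall z, z != 0 -> Q z = (z * Num.conj z) ^+ K j * q j z) HK.
pose M := (\max_j K j)%N.
pose t z : C := z * Num.conj z.
have pt n : polynomial_fun (fun z => t z ^+ n).
  apply: polynomial_funX; apply: polynomial_funM; first exact: polynomial_fun_id.
  exact/polynomial_fun_conj/polynomial_fun_id.
(* This equals (z zbar)^M q_j away from 0, with the same power of the denominator for every [j]. *)
pose S j z := t z ^+ (M - K j) * Q j z.
have pS j : polynomial_fun (S j) by apply: polynomial_funM;
  [exact: pt|exact: (proj1 (HQ j))].
have SE j z : z != 0 -> S j z * Num.conj (S j z) = t z ^+ (M + M) * `|q j z| ^+ 2.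
  move=> z0; rewrite /S (proj2 (HQ j)) // -/(t z) mulrA -exprD subnK;
    last exact: leq_bigmax.
  have tc : Num.conj (t z) = t z by rewrite /t rmorphM/= conjCK mulrC.
  by rewrite rmorphM rmorphXn/= tc normCK exprD; ring.
(* The leading factor z makes [d] vanish at 0, where the identity is not assumed even if 0 belongs
   to [Z]. *)
pose d z := z * (t z ^+ (M + M) * f z + -1 * \sum_j S j z * Num.conj (S j z)).
have [[P PE] _] : polynomial_fun d.
  apply: polynomial_funM; first exact: polynomial_fun_id.
  apply: polynomial_funD; first exact: polynomial_funM.
  apply: polynomial_funM; first exact: polynomial_fun_cst.
  apply: polynomial_fun_sum => j; apply: polynomial_funM => //.
  exact: polynomial_fun_conj.
have dE z : z != 0 -> d z = z * t z ^+ (M + M) * (f z - \sum_(j < N) `|q j z| ^+ 2).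
  move=> z0; rewrite /d; under eq_bigr do rewrite SE//.
  by rewrite -mulr_sumr; ring.
have d0 : forall z, eval_zzbar P z = 0.
  apply: detZ => z Zz; rewrite PE; have [->|z0] := eqVneq z 0;
    first by rewrite /d mul0r.
  by rewrite dE// eqZ// subrr mulr0.
move=> z z0; have := d0 z; rewrite PE dE// => /eqP.
have t0 : t z != 0 by rewrite mulf_neq0// fmorph_eq0.
by rewrite !mulf_eq0 expf_eq0 (negbTE z0) (negbTE t0) andbF/= subr_eq0 => /eqP.
Qed.

End Determining.

(** * Representing functionals nonnegative on nonnegative polynomials *)

Section Haviland.
Variables (R : realType) (T : set (nat * nat)) (c : nat * nat -> R[i]).
Local Notation C := R[i].
Hypothesis symT : symmetric_set T.
Hypothesis diagT : forall n, T (n, n).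
Hypothesis pos : forall p, finite_system T p ->
  (forall z : C, 0 <= pairing T p (fun k => monom k z)) -> 0 <= pairing T p c.

Lemma finite_system0 : finite_system T (fun=> 0 : C).
Proof. by apply: (@finite_system_sub _ _ _ [::]) => k _; rewrite eqxx. Qed.

Lemma pairing0 G : pairing T (fun=> 0 : C) G = 0.
Proof. by apply: fsbig1 => k _; rewrite mul0r. Qed.

Definition two_system (a b : C) k l j : C :=
  a * unit_system R k j + (b * unit_system R l j + 0).

Lemma finite_two_system a b k l : finite_system T (two_system a b k l).
Proof.
apply: finite_system_lin; first exact: finite_unit_system.
by apply: finite_system_lin; [exact: finite_unit_system|exact: finite_system0].
Qed.

Lemma pairing_two_system a b k l G : T k -> T l ->
  pairing T (two_system a b k l) G = a * G k + b * G l.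
Proof.
move=> Tk Tl; have f0 := finite_system0; have fl := finite_unit_system R T l.
rewrite /two_system pairing_lin//; [|exact: finite_unit_system|exact:
  finite_system_lin].
by rewrite pairing_lin// !pairing_unit// pairing0 addr0.
Qed.

Lemma monom_swap (m n : nat) (z : C) : monom (n, m) z = Num.conj (monom (m, n) z).
Proof. by rewrite /monom/= rmorphM !rmorphXn/= conjCK mulrC. Qed.

Lemma moment_diag_ge0 n : 0 <= c (n, n).
Proof.
rewrite -(pairing_unit (T := T) c (diagT n)); apply: pos.
  exact: finite_unit_system.
by move=> z; rewrite pairing_unit// monom_diag exprn_ge0.
Qed.

(** For |l| = 1 the polynomial |1 + l z^m zbar^n|^2 is nonnegative with exponents in [T], so its
    value under the functional is real. Its diagonal part has real moments, which leaves l c(m,n) +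
    conj(l) c(n,m) real; l = 1 and l = i then settle both coordinates. *)
Lemma moment_hermitian m n : T (m, n) -> c (n, m) = Num.conj (c (m, n)).
Proof.
move=> Tmn; have Tnm := symT Tmn; pose D := (m + n)%N.
have Im0 (l : C) : `|l| = 1 ->
    complex.Im (l * c (m, n) + Num.conj l * c (n, m)) = 0.
  move=> l1; pose p k := 1 * two_system l (Num.conj l) (m, n) (n, m) k +
    two_system 1 1 (0%N, 0%N) (D, D) k.
  have pE G : pairing T p G = (l * G (m, n) + Num.conj l * G (n, m)) +
      (G (0%N, 0%N) + G (D, D)).
    rewrite /p pairing_lin; [|exact: finite_two_system|exact: finite_two_system].
    by rewrite !pairing_two_system// !mul1r.
  have : 0 <= pairing T p c.
    apply: pos => [|z].
      by apply: finite_system_lin; exact: finite_two_system.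
    rewrite pE (monom_swap m n) !monom_diag addn0 expr0.
    have -> : `|z| ^+ (D + D) = monom (m, n) z * Num.conj (monom (m, n) z).
      by rewrite -normCK norm_monom exprD expr2.
    have ll : l * Num.conj l = 1 by rewrite -normCK l1 expr1n.
    have -> : l * monom (m, n) z + Num.conj l * Num.conj (monom (m, n) z) +
        (1 + monom (m, n) z * Num.conj (monom (m, n) z)) =
        `|1 + l * monom (m, n) z| ^+ 2.
      rewrite normCK; move: (monom (m, n) z) => w.
      rewrite rmorphD rmorphM rmorph1/=; move: (Num.conj l) (Num.conj w) ll =>
        l' w' ll.
      apply/eqP; rewrite -subr_eq0.
      have -> : l * w + l' * w' + (1 + w * w') - (1 + l * w) * (1 + l' * w') =
        (1 - l * l') * (w * w') by ring.
      by rewrite ll subrr mul0r.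
    by rewrite exprn_ge0.
  rewrite pE => /ger0_Im; rewrite cImD.
  by rewrite [X in _ + X](ger0_Im _) ?addr0// addr_ge0 ?moment_diag_ge0.
have := Im0 1 (normr1 _); have := Im0 'i%C.
rewrite normc_def/= expr0n expr1n add0r sqrtr1 => /(_ erefl).
rewrite conjC1 !mul1r.
by case: (c (m, n)) (c (n, m)) => [a b] [a' b'] /= h1 h2;
  apply/eqP; rewrite eq_complex /=; apply/andP; split; apply/eqP; lra.
Qed.

(** The moment functional on real-valued polynomials with exponents in [T], viewed as functions so
    that the extension theorem applies. *)
Definition moment_graph : set ((C -> R) * R) :=
  [set u | exists p, [/\ finite_system T p,
    forall z, (u.1 z)%:C = pairing T p (fun k => monom k z) &
    u.2%:C = pairing T p c]].

Lemma moment_graph_positive : positive_graph moment_graph.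
Proof.
split=> [a u v [p [fp pE pc]] [q [fq qE qc]]|u [p [fp pE pc]] u0].
  exists (fun k => a%:C * p k + q k); split.
  - exact: finite_system_lin.
  - by move=> z /=; rewrite rmorphD rmorphM/= pE qE pairing_lin.
  - by rewrite /= rmorphD rmorphM/= pc qc pairing_lin.
rewrite -lecR pc; apply: pos => // z.
by rewrite -pE lecR.
Qed.

Lemma moment_graph_diag n :
  moment_graph (fun z => complex.Re (monom (n, n) z), complex.Re (c (n, n))).
Proof.
exists (unit_system R (n, n)); split => [|z|].
- exact: finite_unit_system.
- by rewrite pairing_unit//= RRe_real// monom_diag ger0_real// exprn_ge0.
- by rewrite pairing_unit//= RRe_real// ger0_real// moment_diag_ge0.
Qed.

Lemma moment_graph0 : moment_graph (fun=> 0, 0).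
Proof.
exists (fun=> 0); split => [|z|]; rewrite ?pairing0//; exact: finite_system0.
Qed.

Lemma moment_graph_list u : moment_graph u -> exists (r : seq (nat * nat)) p,
  forall z, (u.1 z)%:C = \sum_(k <- r) p k * monom k z.
Proof.
move=> [p [/finite_system_list[r [ur rT pr]] pE _]]; exists r, p => z.
rewrite pE; apply: fsbig_list => // k Tk pk; apply: pr => //.
by apply: contraNneq pk => ->; rewrite mul0r.
Qed.

Lemma moment_graph_continuous u : moment_graph u ->
  continuous (u.1 : (R[i])^o -> R).
Proof.
move=> /moment_graph_list[r [p uE]].
have -> : u.1 = (fun z => complex.Re (\sum_(k <- r) p k * monom k z)).
  by apply/funext => z; rewrite -uE.
suff [] : continuous_ReIm (fun z => \sum_(k <- r) p k * monom k z) by [].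
apply: continuous_ReIm_sum => k; apply: continuous_ReImM.
  exact: continuous_ReIm_cst.
exact: continuous_ReIm_monom.
Qed.

(** If s is the sum of the coefficient moduli and D bounds the degrees, then |u| <= s (1 + |z|^D),
    hence u^2 <= 2 s^2 (1 + |z|^(2D)). The right side is diagonal and so belongs to the graph. *)
Lemma moment_graph_dominated u : moment_graph u ->
  exists2 v, moment_graph v & forall z, u.1 z ^+ 2 <= v.1 z.
Proof.
move=> /moment_graph_list[r [p uE]].
pose S := \sum_(k <- r) `|p k|; pose s := complex.Re S.
have sE : s%:C = S by rewrite RRe_real// ger0_real// sumr_ge0.
pose D := (\sum_(k <- r) (k.1 + k.2))%N.
have [lin _] := moment_graph_positive.
have G1 := lin 1 _ _ (moment_graph_diag 0) (moment_graph_diag D).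
have G2 := lin (2 * s ^+ 2) _ _ G1 moment_graph0.
eexists; first exact: G2.
move=> z; change (u.1 z ^+ 2 <= 2 * s ^+ 2 * (1 * complex.Re (monom (0, 0)%N z) +
  complex.Re (monom (D, D) z)) + 0).
rewrite addr0 mul1r.
pose x := complex.Re (`|z| ^+ D).
have xE : x%:C = `|z| ^+ D by rewrite RRe_real// ger0_real// exprn_ge0.
have x0 : 0 <= x by rewrite -lecR xE exprn_ge0.
have s0 : 0 <= s by rewrite -lecR sE sumr_ge0.
have -> : complex.Re (monom (0, 0)%N z) = 1 by rewrite monom_diag expr0.
have -> : complex.Re (monom (D, D) z) = x ^+ 2.
  by rewrite monom_diag exprD -xE -rmorphM/= -expr2.
have ux : `|u.1 z| <= s * (1 + x).
  rewrite -lecR rmorphM rmorphD rmorph1/= sE xE.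
  have -> : `|u.1 z|%:C = `|(u.1 z)%:C|.
    by rewrite normc_def/= expr0n/= addr0 sqrtr_sqr.
  rewrite uE; apply: le_trans (ler_norm_sum _ _ _) _.
  rewrite /S mulr_suml big_seq [leRHS]big_seq; apply: ler_sum => k kr.
  rewrite normrM ler_wpM2l// norm_monom exp_le_sqr//.
  by rewrite /D (big_rem k)//= leq_addr.
rewrite -real_normK ?num_real//.
apply: (@le_trans _ _ ((s * (1 + x)) ^+ 2)).
  by rewrite ler_sqr// nnegrE mulr_ge0// addr_ge0.
have le2 : (1 + x) ^+ 2 <= 2 * (1 + x ^+ 2) by have := sqr_ge0 (1 - x); lra.
rewrite exprMn; apply: le_trans (ler_wpM2l (sqr_ge0 s) le2) _.
by rewrite mulrA [_ * 2]mulrC.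
Qed.

Lemma positive_pairing_measure :
  exists mu : {measure set (complexBorel R) -> \bar R}, represents_on T c mu.
Proof.
have G1 : moment_graph (fun=> 1, complex.Re (c (0, 0)%N)).
  have := moment_graph_diag 0; congr moment_graph; congr (_, _).
  by apply/funext => z; rewrite monom_diag expr0.
have Gs : moment_graph (fun z => complex.Re z ^+ 2 + complex.Im z ^+ 2,
    complex.Re (c (1, 1)%N)).
  have := moment_graph_diag 1; congr moment_graph; congr (_, _).
  by apply/funext => z; rewrite monom_diag -add_Re2_Im2.
have [mu hmu] := representing_measure moment_graph_positive
  moment_graph_continuous moment_graph_dominated G1 Gs.
exists mu => -[m n] Tmn; have Tnm := symT Tmn.
(* Real and imaginary parts combine the monomials (m, n) and (n, m), both in [T] by symmetry;
   hermitian symmetry of [c] gives the matching moments. *)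
have GRe : moment_graph (fun z => complex.Re (monom (m, n) z), complex.Re (c
  (m, n))).
  exists (two_system 2^-1 2^-1 (m, n) (n, m)); split => [|z|].
  - exact: finite_two_system.
  - rewrite pairing_two_system// (monom_swap m n) -mulrDr mulrC.
    exact: ReJ_add.
  - rewrite pairing_two_system// (moment_hermitian Tmn) -mulrDr mulrC.
    exact: ReJ_add.
have ImE (x : C) : (complex.Im x)%:C =
    - 2^-1 * 'i%C * x + 2^-1 * 'i%C * Num.conj x.
  by apply: etrans (ImJ_sub x) _; rewrite -[conjc x]/(Num.conj x); ring.
have GIm : moment_graph (fun z => complex.Im (monom (m, n) z), complex.Im (c
  (m, n))).
  exists (two_system (- 2^-1 * 'i%C) (2^-1 * 'i%C) (m, n) (n, m)); split => [|z|].
  - exact: finite_two_system.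
  - by rewrite pairing_two_system// (monom_swap m n) -ImE.
  - by rewrite pairing_two_system// (moment_hermitian Tmn) -ImE.
have [i1 e1] := hmu _ GRe; have [i2 e2] := hmu _ GIm.
split; first by split.
by rewrite /cintegral; move: e1 e2 => /= -> ->; case: (c _).
Qed.

End Haviland.

Theorem theorem20 (R : realType) (T : set (nat * nat)) (Z : set R[i])
    (c : nat * nat -> R[i])
    (symT : symmetric_set T)
    (diagT : forall n : nat, T (n, n))
    (detZ : determining Z) :
  [<->
    (* (i) *)
    exists mu : {measure set (complexBorel R) -> \bar R},
      represents_on T c mu;
    (* (ii) *)
    exists ct : nat * nat -> R[i],
      complex_moment_sequence ct /\ forall k, T k -> ct k = c k;
    (* (iii) *)
    exists ct : int * int -> R[i],
      (forall m n : nat, T (m, n) -> ct (m%:Z, n%:Z) = c (m, n)) /\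
      forall lam : int * int -> R[i], finite_system Nplus lam ->
        0 <= \sum_(u \in Nplus `*` Nplus)
               ct (u.1.1 + u.2.2, u.1.2 + u.2.1) * lam u.1 * Num.conj (lam u.2);
    (* (iv) *)
    forall p : nat * nat -> R[i], finite_system T p ->
      (forall z : R[i], 0 <= \sum_(k \in T) p k * monom k z) ->
      0 <= \sum_(k \in T) p k * c k;
    (* (v) *)
    forall p : nat * nat -> R[i], finite_system T p ->
      (exists (N : nat) (q : 'I_N -> R[i] -> R[i]),
        (forall j, in_CNplus (q j)) /\
        forall z : R[i], z != 0 ->
          \sum_(k \in T) p k * monom k z = \sum_(j < N) `|q j z| ^+ 2) ->
      0 <= \sum_(k \in T) p k * c k;
    (* (vi) *)
    forall p : nat * nat -> R[i], finite_system T p ->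
      (exists (N : nat) (q : 'I_N -> R[i] -> R[i]),
        (forall j, in_CNplus (q j)) /\
        forall z : R[i], Z z -> z != 0 ->
          \sum_(k \in T) p k * monom k z = \sum_(j < N) `|q j z| ^+ 2) ->
      0 <= \sum_(k \in T) p k * c k].
Proof.
tfae.
- move=> [mu muc]; exists (fun k => cintegral mu (monom k)); split.
    by exists mu; exact: complex_moment_extension muc.
  by move=> k /muc[].
- move=> [ct [/complex_moment_gram_ge0[d [dct d0]] ctc]].
  by exists d; split=> // m n Tmn; rewrite dct ctc.
- move=> [ct [ctc ct0]] p fp p0; exact: (gram_ge0_pairing_ge0 diagT ctc ct0).
- move=> pos p fp [N [q [qN qE]]]; apply: pos => // z.
  have pz w : w != 0 -> 0 <= pairing T p (fun k => monom k w).
    by move=> w0; rewrite /pairing qE// sumr_ge0// => j _; rewrite exprn_ge0.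
  (* The sum of squares gives the sign only away from 0; the value at 0 follows by a limit. *)
  have [->|z0] := eqVneq z 0; last exact: pz.
  exact: pairing_ge0_at0.
- move=> sos p fp [N [q [qN qE]]]; apply: sos => //; exists N, q; split=> //.
  apply: (determining_sos detZ) => //.
  have [r [ur rT pr]] := finite_system_list fp.
  have -> : (fun z => \sum_(k \in T) p k * monom k z) =
      (fun z => \sum_(k <- r) p k * monom k z).
    apply/funext => z; apply: fsbig_list => // k Tk pk; apply: pr => //.
    by apply: contraNneq pk => ->; rewrite mul0r.
  apply: polynomial_fun_sum => k; apply: polynomial_funM.
    exact: polynomial_fun_cst.
  exact: polynomial_fun_monom.
(* An identity valid at all z <> 0 holds in particular on [Z], so (vi) covers the certificates of
   nonnegative polynomials. The resulting positivity yields the measure and closes the cycle. *)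
- move=> sosZ; apply: positive_pairing_measure => // p fp p0.
  apply: sos_pairing_ge0 => // q fq [N [f [fN fE]]].
  by apply: sosZ => //; exists N, f; split=> // z _; exact: fE.
Qed.
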